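(* For all integers $d \ge 2$ and $m \ge d$, the constant $c(m,d)$ satisfies \[ d^{-50d^3}m^{-d^2} \le c(m,d) \le d^d m^{-d}. \]
   Context: A family of finite sets $X_1,\dots,X_m\subseteq\mathbb{R}^d$ is said to be in general position if the sets are pairwise disjoint and their union is a set of points in general position. Sets $Y_1,\dots,Y_{d+1}\subseteq\mathbb{R}^d$ have the same-type property if for every choice $y_1\in Y_1,\dots,y_{d+1}\in Y_{d+1}$ the orientation of the $(d+1)$-tuple $(y_1,\dots,y_{d+1})$ (the sign of the determinant of the affine coordinates) is the same; sets $Y_1,\dots,Y_m$ have the same-type property if every $d+1$ of them do. For a family $X_1,\dots,X_m$ of nonempty finite sets in general position, $c(X_1,\dots,X_m)$ denotes the largest $c$ such that there exist $Y_1\subseteq X_1,\dots,Y_m\subseteq X_m$ with the same-type property and $|Y_i|\ge c|X_i|$ for all $i$. The constant $c(m,d)$ is the infimum of $c(X_1,\dots,X_m)$ over all such families of $m$ finite sets in $\mathbb{R}^d$. *)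

(* Defs.v *)
From HB Require Import structures.
From mathcomp Require Import all_boot all_order all_algebra.
From mathcomp Require Import finmap.
From mathcomp Require Import boolp classical_sets reals.
Set Implicit Arguments. Unset Strict Implicit. Unset Printing Implicit Defensive.
Import Order.TTheory GRing.Theory Num.Theory.
Local Open Scope ring_scope.
Local Open Scope fset_scope.

Section Defs.
Variable R : realType.
Variable d : nat.

Definition pt := 'rV[R]_d.

Definition affmx k (p : 'I_k -> pt) : 'M[R]_(k, 1 + d) :=
  \matrix_(i < k) row_mx (const_mx 1 : 'rV[R]_1) (p i).

Definition orientation (y : 'I_d.+1 -> pt) : R := Num.sg (\det (affmx y)).

Definition gen_pos (S : {fset pt}) : Prop :=
  forall k (p : 'I_k -> pt), (k <= d.+1)%N -> injective p ->
    (forall i, p i \in S) -> \rank (affmx p) = k.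

Definition family_gen_pos m (X : 'I_m -> {fset pt}) : Prop :=
  (forall i j, i != j -> [disjoint X i & X j]) /\
  gen_pos (\big[fsetU/fset0]_(i < m) X i).

Definition same_type m (Y : 'I_m -> {fset pt}) : Prop :=
  forall f : 'I_d.+1 -> 'I_m, injective f ->
    forall y y' : 'I_d.+1 -> pt,
      (forall j, y j \in Y (f j)) -> (forall j, y' j \in Y (f j)) ->
      orientation y = orientation y'.

Definition cX m (X : 'I_m -> {fset pt}) : R :=
  sup [set c : R | exists Y : 'I_m -> {fset pt},
          (forall i, Y i `<=` X i) /\ same_type Y /\
          (forall i, c * (#|` X i|)%:R <= (#|` Y i|)%:R)].

Definition c_md m : R :=
  inf [set c : R | exists X : 'I_m -> {fset pt},
          (forall i, X i != fset0) /\ family_gen_pos X /\ c = cX X].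
End Defs.

(* Main.v *)
Require Import Defs.
From HB Require Import structures.
From mathcomp Require Import all_boot all_order all_algebra.
From mathcomp Require Import finmap.
From mathcomp Require Import boolp reals.
From mathcomp Require Import zify ring lra.
Set Implicit Arguments. Unset Strict Implicit. Unset Printing Implicit Defensive.
Import Order.TTheory GRing.Theory Num.Theory.
Local Open Scope ring_scope.

(** Upper bound.  Let every [X i] be a perturbed copy of the grid [N^d].  If a hyperplane [x_j = const] separated
    points of [d+1] of the [Y i], then, by multilinearity, a determinant with rows on that hyperplane would be a
    positive combination of determinants of one sign.  So each of the [d N] hyperplanes separating the layers of
    the grids cuts at most [d] of the [Y i]; hence some [Y i] has total width at most [d^2 N / m], and by AM-GM it
    contains at most [(d N / m + 1)^d] points.  Let [N] tend to infinity.

    Lower bound.  For each [X i] there is a probability distribution on simplices containing a fraction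
    [t] of [X i] such that every hyperplane crosses the random simplex with probability [O(t^(1/d))].  By
    multiplicative weights it suffices to find, for every distribution on a finite set of test hyperplanes, one
    large simplex that is crossed rarely; it is taken from the bottom-vertex triangulation of the arrangement of a
    random sample of [r] hyperplanes.  This triangulation has [O(r^d)] simplices, each determined by [O(d^2)]
    hyperplanes, so the simplex of a fixed point is crossed by the next random hyperplane with probability
    [O(d^2 / r)].  Choosing the simplices of the [X i] independently, [d+1] of them have a common transversal
    hyperplane with probability [O(1 / r)], since such a hyperplane may be taken through vertices of [d] of them.
    For [r] of order [m^d], Rosenfeld's counting form of the local lemma yields a choice without transversals,
    and the resulting fraction is of order [r^(-d) = m^(-d^2)]. *)

(** * Dot products and orthogonal vectors *)

Section Dot.
Variables (R : realFieldType) (n : nat).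
Implicit Types u v w : 'rV[R]_n.

Definition dot u v : R := \sum_i u 0 i * v 0 i.

Lemma dotC u v : dot u v = dot v u.
Proof. by apply: eq_bigr => i _; rewrite mulrC. Qed.

Lemma dotDl u v w : dot (u + v) w = dot u w + dot v w.
Proof. by rewrite -big_split; apply: eq_bigr => i _; rewrite mxE mulrDl. Qed.

Lemma dotZl a u w : dot (a *: u) w = a * dot u w.
Proof. by rewrite mulr_sumr; apply: eq_bigr => i _; rewrite mxE mulrA. Qed.

Lemma dotNl u w : dot (- u) w = - dot u w.
Proof. by rewrite -scaleN1r dotZl mulN1r. Qed.

Lemma dotBl u v w : dot (u - v) w = dot u w - dot v w.
Proof. by rewrite dotDl dotNl. Qed.

Lemma dot0l w : dot 0 w = 0.
Proof. by rewrite -(scale0r 0) dotZl mul0r. Qed.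

Lemma dotDr u v w : dot w (u + v) = dot w u + dot w v.
Proof. by rewrite !(dotC w) dotDl. Qed.

Lemma dotZr a u w : dot w (a *: u) = a * dot w u.
Proof. by rewrite !(dotC w) dotZl. Qed.

Lemma dotNr u w : dot w (- u) = - dot w u.
Proof. by rewrite !(dotC w) dotNl. Qed.

Lemma dotBr u v w : dot w (u - v) = dot w u - dot w v.
Proof. by rewrite !(dotC w) dotBl. Qed.

Lemma dot0r w : dot w 0 = 0.
Proof. by rewrite dotC dot0l. Qed.

Lemma dot_suml (I : Type) (r : seq I) (P : pred I) (F : I -> 'rV[R]_n) w :
  dot (\sum_(i <- r | P i) F i) w = \sum_(i <- r | P i) dot (F i) w.
Proof.
by elim/big_rec2: _ => [|i x y _ <-]; rewrite ?dot0l // dotDl.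
Qed.

Lemma dot_delta j w : dot (delta_mx 0 j) w = w 0 j.
Proof.
rewrite /dot (bigD1 j) //= big1 => [|i /negPf ne]; rewrite mxE ?eqxx /= ?mul1r ?addr0 //.
by rewrite ne mul0r.
Qed.

Lemma exists_orthogonal k (f : 'I_k -> 'rV[R]_n) :
  (k < n)%N -> exists2 g, g != 0 & forall i, dot (f i) g = 0.
Proof.
move=> lt_kn; pose A := (\matrix_i f i)^T : 'M[R]_(n, k).
have /eqP/rowV0Pn[g /sub_kermxP gA g0] : kermx A <> 0.
  move=> K0; have := mxrank_ker A; rewrite K0 mxrank0 => /esym/eqP.
  by rewrite subn_eq0 leqNgt (leq_ltn_trans (rank_leq_col A)).
exists g => // i; move/rowP/(_ i): gA; rewrite !mxE => gAi.
by rewrite -[RHS]gAi dotC; apply: eq_bigr => j _; rewrite !mxE.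
Qed.

Lemma exists_orthogonal_seq (s : seq 'rV[R]_n) :
  (size s < n)%N -> exists2 g, g != 0 & {in s, forall u, dot u g = 0}.
Proof.
move=> /(exists_orthogonal (fun i => nth 0 s i))[g g0 gs]; exists g => // u us.
have lt := us; rewrite -index_mem in lt.
by have := gs (Ordinal lt); rewrite /= nth_index.
Qed.

End Dot.

(** * Generic choices avoiding finitely many zero sets *)

Section Avoid.
Variable R : realFieldType.

Lemma exists_nonroot (ps : seq {poly R}) (t0 : R) :
  all (fun p => p != 0) ps -> exists2 t, t0 < t & all (fun p : {poly R} => p.[t] != 0) ps.
Proof.
move=> nz; pose p := \prod_(q <- ps) q.
have p0 : p != 0 by rewrite /p prodf_seq_neq0; apply: sub_all nz => q ->.
pose s := [seq t0 + (i.+1)%:R | i <- iota 0 (size p)].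
have us : uniq s.
  by rewrite map_inj_uniq ?iota_uniq // => i j /addrI/eqP; rewrite eqr_nat => /eqP[].
have : ~~ all (root p) s.
  apply/negP => rs; have := max_poly_roots p0 rs us.
  by rewrite size_map size_iota ltnn.
case/allPn=> t /mapP[i _ ->] nr; exists (t0 + i.+1%:R); first by rewrite ltrDl ltr0n.
have := nr; rewrite rootE /p horner_prod prodf_seq_neq0.
by apply: sub_all => q /=.
Qed.

(** With [c j = t ^+ j], [dot h] of the combination is a polynomial in [t] with coefficients
    [dot h (v j)]. If [t] avoids the roots of the nonzero ones among these polynomials, a zero value
    forces all coefficients to vanish. *)
Lemma exists_generic_point n k (F : seq 'rV[R]_n) (v : 'I_k -> 'rV[R]_n) :
  exists2 c : 'I_k -> R, forall j, 0 <= c j &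
    {in F, forall h, dot h (\sum_j c j *: v j) = 0 -> forall j, dot h (v j) = 0}.
Proof.
pose pol h : {poly R} := \poly_(i < k) (if insub i is Some j then dot h (v j) else 0).
have polE h t : (pol h).[t] = dot h (\sum_(j < k) (t ^+ j) *: v j).
  rewrite horner_poly dotC dot_suml; apply: eq_bigr => j _.
  by rewrite valK dotZl mulrC dotC.
have pol0 h : pol h = 0 -> forall j, dot h (v j) = 0.
  move=> p0 j; have := coef_poly k (fun i => if insub i is Some j then dot h (v j) else 0) j.
  by rewrite -/(pol h) p0 coef0 ltn_ord valK => <-.
have [|t t0 /allP nr] := @exists_nonroot [seq pol h | h <- F & pol h != 0] 0.
  by apply/allP => p /mapP[h]; rewrite mem_filter => /andP[? _] ->.
exists (fun j => t ^+ j) => [j|h hF]; first by rewrite exprn_ge0 ?ltW.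
move=> e; apply: pol0; apply/eqP/negP => /negP nz.
have /nr : pol h \in [seq pol h | h <- F & pol h != 0].
  by apply: map_f; rewrite mem_filter nz.
by rewrite polE e eqxx.
Qed.

(** A generic combination of the basis vectors is tested against all differences [z i - z j]: it
    annihilates one only if all its coordinates are zero. *)
Lemma exists_separating_functional n (I : finType) (z : I -> 'rV[R]_n) :
  exists l, forall i j, dot l (z i) = dot l (z j) -> z i = z j.
Proof.
have [c _ cP] := exists_generic_point [seq z p.1 - z p.2 | p : I * I]
                    (fun j : 'I_n => delta_mx 0 j).
exists (\sum_j c j *: delta_mx 0 j) => i j /eqP; rewrite -subr_eq0 -dotBr dotC => /eqP e.
apply/eqP; rewrite -subr_eq0; apply/eqP/rowP => k; rewrite [RHS]mxE -dot_delta dotC.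
by apply: cP e k; apply/mapP; exists (i, j); rewrite ?mem_enum.
Qed.

End Avoid.

(** * Determinants as functions of their rows *)

Section Det.
Variables (R : realFieldType) (n : nat).
Implicit Types p : 'I_n -> 'rV[R]_n.

Definition upd (A : Type) (p : 'I_n -> A) l x : 'I_n -> A := fun i => if i == l then x else p i.

Definition detrows p : R := \det (\matrix_i p i).

Lemma eq_detrows p p' : p =1 p' -> detrows p = detrows p'.
Proof. by move=> e; congr (\det _); apply/matrixP => i j; rewrite !mxE e. Qed.

(** Represents the determinant as a linear functional of row [l]; if nonzero, it is a normal vector
    of the hyperplane spanned by the other rows. *)
Definition cofrow p l : 'rV[R]_n := \row_j cofactor (\matrix_i p i) l j.

Lemma detrows_upd p l x : detrows (upd p l x) = dot x (cofrow p l).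
Proof.
rewrite /detrows (expand_det_row _ l); apply: eq_bigr => j _.
rewrite !mxE /upd eqxx; congr (_ * _); rewrite /cofactor; congr (_ * \det _).
by apply/matrixP => i k; rewrite !mxE eq_sym (negPf (neq_lift _ _)).
Qed.

Lemma detrows_cofrow p l : detrows p = dot (p l) (cofrow p l).
Proof.
by rewrite -detrows_upd; apply: eq_detrows => i; rewrite /upd; case: eqP => [->|].
Qed.

Lemma cofrow_upd p l x : cofrow (upd p l x) l = cofrow p l.
Proof.
apply/rowP => j; rewrite !mxE /cofactor; congr (_ * \det _).
by apply/matrixP => i k; rewrite !mxE /upd eq_sym (negPf (neq_lift _ _)).
Qed.

Lemma detrows_eq0P p : reflect (exists2 y, y != 0 & forall i, dot (p i) y = 0) (detrows p == 0).
Proof.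
apply: (iffP idP) => [d0|[y y0 py]].
  have /det0P[y y0 yp] : \det (\matrix_i p i)^T == 0 by rewrite det_tr.
  exists y => // i; move/rowP/(_ i): yp; rewrite !mxE => yp.
  by rewrite -[RHS]yp dotC; apply: eq_bigr => j _; rewrite !mxE.
rewrite /detrows -det_tr; apply/det0P; exists y => //.
apply/rowP => i; rewrite [RHS]mxE -(py i) mxE dotC; apply: eq_bigr => j _.
by rewrite !mxE.
Qed.

(** Rows pass from [A] to [A'] one at a time. With the other rows fixed the determinant is a linear
    functional of the row, so a hypothesis on single functionals [w] suffices. *)
Lemma detrows_propagate (P : R -> Prop) (A A' : 'I_n -> 'rV[R]_n -> Prop) :
  (forall i w, (forall a, A i a -> P (dot a w)) -> forall a, A' i a -> P (dot a w)) ->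
  (forall p, (forall i, A i (p i)) -> P (detrows p)) ->
  forall p, (forall i, A' i (p i)) -> P (detrows p).
Proof.
move=> AA' PA p Ap.
suff H k : forall p, (forall i : 'I_n, if (i < k)%N then A' i (p i) else A i (p i)) -> P (detrows p).
  by apply: (H n) => i; rewrite ltn_ord.
elim: k => [|k IH] {Ap}p Hp; first by apply: PA => i; have := Hp i.
have [le_nk|lt_kn] := leqP n k.
  by apply: IH => i; have := Hp i; rewrite !ltnS (leq_trans (ltn_ord i)) // ltnW ?(leq_trans (ltn_ord i)).
pose l := Ordinal lt_kn; rewrite (detrows_cofrow p l).
apply: (AA' l); last by have := Hp l; rewrite /= ltnSn.
move=> a Aa; rewrite -detrows_upd; apply: IH => i; rewrite /upd.
case: eqP => [->|/eqP ne]; first by rewrite ltnn.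
have := Hp i; rewrite ltnS leq_eqVlt.
by have /negPf -> : nat_of_ord i != k by [].
Qed.

End Det.

(** * Hyperplane arrangements and bottom-vertex triangulations *)

Section Compat.
Variable R : realFieldType.
Implicit Types a b c : R.

(* [b] lies in the closure of the sign class of [a]. *)
Definition compat a b := (0 <= a * b) && ((a == 0) ==> (b == 0)).

Lemma compat_refl a : compat a a.
Proof. by rewrite /compat implybb andbT -expr2 sqr_ge0. Qed.

Lemma compat_sg a b : compat a b -> b != 0 -> Num.sg a = Num.sg b.
Proof.
case/andP=> ab /implyP a0 b0; have {}a0 : a != 0 by apply: contraNneq b0 => /eqP/a0.
have : 0 < a * b by rewrite lt_def mulf_neq0.
move/gtr0_sg; rewrite sgrM => sab.
have sb : Num.sg b * Num.sg b = 1 by rewrite -expr2 sqr_sg b0.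
by rewrite -[LHS]mulr1 -sb mulrA sab mul1r.
Qed.

Lemma compatE a b : compat a b = [|| b == 0 | (a != 0) && (Num.sg a == Num.sg b)].
Proof.
apply/idP/idP => [c|/orP[/eqP->|/andP[a0 /eqP sab]]].
- have [//|b0 /=] := eqVneq b 0.
  rewrite (compat_sg c b0) eqxx andbT; apply: contraNneq b0 => a0.
  by case/andP: c => _; rewrite a0 eqxx.
- by rewrite /compat mulr0 lexx eqxx implybT.
- rewrite /compat (negPf a0) andbT [a]numEsg [b]numEsg sab mulrACA -expr2.
  by rewrite mulr_ge0 ?sqr_ge0 ?mulr_ge0.
Qed.

Lemma compat_trans a b c : compat a b -> compat b c -> compat a c.
Proof.
rewrite !compatE => ab /orP[->//|/andP[b0 /eqP <-]].
by move: ab; rewrite (negPf b0) => /= ->; rewrite orbT.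
Qed.

Lemma compat_ge0 a b : compat a b -> 0 <= a -> 0 <= b.
Proof.
rewrite compatE => /orP[/eqP->//|/andP[_ /eqP sab]].
by rewrite -sgr_ge0 sab sgr_ge0.
Qed.

Lemma compat_le0 a b : compat a b -> a <= 0 -> b <= 0.
Proof.
rewrite compatE => /orP[/eqP->//|/andP[_ /eqP sab]].
by rewrite -sgr_le0 sab sgr_le0.
Qed.

Lemma compat_eq0 a b : compat a b -> a = 0 -> b = 0.
Proof. by case/andP=> _ /implyP h /eqP/h/eqP. Qed.

Lemma compatD a b c : compat a b -> compat a c -> compat a (b + c).
Proof.
case/andP=> ab /implyP hb /andP[ac /implyP hc]; rewrite /compat mulrDr addr_ge0 //=.
by apply/implyP => /[dup] /hb/eqP-> /hc/eqP->; rewrite addr0.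
Qed.

Lemma compatZ a b s : 0 <= s -> compat a b -> compat a (s * b).
Proof.
move=> s0 /andP[ab /implyP hb]; rewrite /compat mulrCA mulr_ge0 //=.
by apply/implyP => /hb/eqP->; rewrite mulr0.
Qed.

End Compat.

Section Arrangement.
Variables (R : realFieldType) (d : nat) (H : finType) (q : H -> 'rV[R]_d.+1).
Implicit Types (S T : {set H}) (x y z v w : 'rV[R]_d.+1) (h : H).

(* Points and hyperplanes are given by homogeneous coordinates, so that [gp] says that no [d+1] of the
   hyperplanes [q h] have a common point. *)
Hypothesis gp : forall x, x != 0 -> (#|[set h | dot (q h) x == 0%R]| <= d)%N.

Definition zset S x := [set h in S | dot (q h) x == 0].

(* The closed face of the arrangement [S] with [x] in its relative interior. *)
Definition cell S x z := [forall h in S, compat (dot (q h) x) (dot (q h) z)].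

Lemma zset_sub S x : zset S x \subset S.
Proof. by apply/subsetP => h; rewrite inE => /andP[]. Qed.

Lemma zset_leq S x : x != 0 -> (#|zset S x| <= d)%N.
Proof.
move/gp; apply: leq_trans; apply: subset_leq_card.
by apply/subsetP => h; rewrite !inE => /andP[].
Qed.

Lemma zsetS S' S x : S' \subset S -> zset S x \subset S' -> zset S' x = zset S x.
Proof.
move=> /subsetP sS' /subsetP sz; apply/setP => h; rewrite !inE.
case h0 : (dot (q h) x == 0); rewrite ?andbF // !andbT.
by apply/idP/idP => [/sS'//|hS]; apply: sz; rewrite inE hS h0.
Qed.

Lemma zsetZ S x s : s != 0 -> zset S (s *: x) = zset S x.
Proof. by move=> s0; apply/setP => h; rewrite !inE dotZr mulf_eq0 (negPf s0). Qed.

Lemma exists_nonzero S x : (d < #|S|)%N -> x != 0 -> exists2 h, h \in S & dot (q h) x != 0.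
Proof.
move=> dS x0; have : ~~ (S \subset zset S x).
  by apply: contraL (zset_leq S x0) => /subset_leq_card; rewrite -ltnNge; apply: leq_trans.
by case/subsetPn => h hS; rewrite inE hS /= => h0; exists h.
Qed.

Lemma cellP S x z : reflect {in S, forall h, compat (dot (q h) x) (dot (q h) z)} (cell S x z).
Proof. exact: 'forall_in_idP. Qed.

Lemma cell_refl S x : cell S x x.
Proof. by apply/cellP => h _; apply: compat_refl. Qed.

Lemma cell_trans S x y z : cell S x y -> cell S y z -> cell S x z.
Proof. by move=> /cellP xy /cellP yz; apply/cellP => h hS; apply: compat_trans (xy h hS) (yz h hS). Qed.

Lemma cellS S' S x z : S' \subset S -> cell S x z -> cell S' x z.
Proof. by move=> /subsetP sS /cellP c; apply/cellP => h /sS; apply: c. Qed.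

Lemma cellZ S x z s : 0 <= s -> cell S x z -> cell S x (s *: z).
Proof. by move=> s0 /cellP c; apply/cellP => h hS; rewrite dotZr; apply: compatZ (c h hS). Qed.

Lemma cell_zset S x z : cell S x z -> zset S x \subset zset S z.
Proof.
move=> /cellP c; apply/subsetP => h; rewrite !inE => /andP[hS /eqP h0].
by rewrite hS; apply/eqP; apply: compat_eq0 h0; apply: c.
Qed.

(** Among the hyperplanes that the ray approaches, [F h] is the parameter at which it meets [h]. Up
    to the least such parameter the ray stays in the closed face, and there the zero set grows. *)
Lemma ray_exit S x g :
  {in zset S x, forall h, dot (q h) g = 0} ->
  (exists2 h, h \in S & dot (q h) x * dot (q h) g < 0) ->
  exists2 s, 0 < s & cell S x (x + s *: g) /\ zset S x \proper zset S (x + s *: g).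
Proof.
move=> g0 [h0 h0S h0neg].
pose P h := (h \in S) && (dot (q h) x * dot (q h) g < 0).
pose F h := - dot (q h) x / dot (q h) g.
have Ph0 : P h0 by rewrite /P h0S.
case: (Order.TotalTheory.arg_minP F Ph0) => h1 /andP[h1S h1neg] h1min.
have Fpos : 0 < F h1.
  rewrite /F; have [g_gt|g_lt|g_eq] := ltrgt0P (dot (q h1) g).
  - by rewrite divr_gt0 // oppr_gt0; move: h1neg; rewrite pmulr_llt0.
  - by rewrite nmulr_rgt0 ?invr_lt0 // oppr_lt0; move: h1neg; rewrite nmulr_llt0.
  - by move: h1neg; rewrite g_eq mulr0 ltxx.
exists (F h1) => //; have c : cell S x (x + F h1 *: g).
  apply/cellP => h hS; rewrite dotDr dotZr /compat.
  have [a0|a0] := eqVneq (dot (q h) x) 0.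
    have b0 : dot (q h) g = 0 by apply: g0; rewrite inE hS a0 eqxx.
    by rewrite b0 a0 mulr0 addr0 mulr0 lexx eqxx.
  rewrite implyFb andbT mulrDr; have [ab|ab] := leP 0 (dot (q h) x * dot (q h) g).
    by rewrite addr_ge0 ?sqr_ge0 -?expr2 // mulrCA mulr_ge0 // ltW.
  have := h1min h; rewrite /P hS ab => /(_ isT) le.
  have b0 : dot (q h) g != 0 by apply: contraTneq ab => ->; rewrite mulr0 ltxx.
  have : F h * - (dot (q h) x * dot (q h) g) = dot (q h) x * dot (q h) x by rewrite /F; field.
  move=> e; rewrite -e mulrCA.
  have : 0 <= (F h - F h1) * - (dot (q h) x * dot (q h) g).
    by rewrite mulr_ge0 ?subr_ge0 // oppr_ge0 ltW.
  by rewrite mulrBl !mulrN opprK.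
split=> //; apply/properP; split; first exact: cell_zset.
have b0 : dot (q h1) g != 0 by apply: contraTneq h1neg => ->; rewrite mulr0 ltxx.
exists h1; rewrite inE h1S /=; last by apply: contraTneq h1neg => ->; rewrite mul0r ltxx.
by rewrite dotDr dotZr; apply/eqP; rewrite /F; field.
Qed.

Lemma cell_move S x : (d < #|S|)%N -> x != 0 -> (#|zset S x| < d)%N ->
  exists2 y, y != 0 & cell S x y /\ (#|zset S x| < #|zset S y|)%N.
Proof.
(* The direction [g] is chosen orthogonal to [ell] too. Since [ell] sums the values with the signs
   of [x], some value must shrink along [g]; since [ell] is positive at [x] and constant along the
   ray, the exit point is not [0]. *)
move=> dS x0 zx; pose ell := \sum_(h in S) Num.sg (dot (q h) x) *: q h.
have [|g gn0 gP] := @exists_orthogonal_seq _ _ (ell :: [seq q h | h <- enum (zset S x)]).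
  by rewrite /= size_map -cardE ltnS.
have ellE w : dot ell w = \sum_(h in S) Num.sg (dot (q h) x) * dot (q h) w.
  by rewrite dot_suml; apply: eq_bigr => h _; rewrite dotZl.
have g0 : {in zset S x, forall h, dot (q h) g = 0}.
  by move=> h hz; apply: gP; rewrite inE map_f ?orbT // mem_enum.
have : exists2 h, h \in S & dot (q h) x * dot (q h) g < 0.
  have [h1 h1S h1g] := exists_nonzero dS gn0.
  have := gP ell (mem_head _ _); rewrite ellE => sum0.
  have [|no] := boolP [exists h in S, Num.sg (dot (q h) x) * dot (q h) g < 0].
    case/exists_inP => h hS lt0; exists h => //.
    rewrite [dot (q h) x]numEsg mulrAC nmulr_rlt0 // normr_gt0.
    by apply: contraTneq lt0 => ->; rewrite sgr0 mul0r ltxx.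
  have ge0 h : h \in S -> 0 <= Num.sg (dot (q h) x) * dot (q h) g.
    by move=> hS; rewrite leNgt; apply: contra no => lt; apply/exists_inP; exists h.
  have /eqP := psumr_eq0P ge0 sum0 h1S; rewrite mulf_eq0 (negPf h1g) orbF sgr_eq0 => h1x.
  by move: h1g; rewrite g0 ?eqxx // inE h1S h1x.
case/(ray_exit g0) => s s0 [c /proper_card lt]; exists (x + s *: g) => //.
have [h1 h1S h1x] := exists_nonzero dS x0.
have : 0 < dot ell (x + s *: g).
  rewrite dotDr dotZr (gP ell (mem_head _ _)) mulr0 addr0 ellE (bigD1 h1) //=.
  rewrite ltr_wpDr ?sumr_ge0 // => [h _|]; first by rewrite -normrEsg.
  by rewrite -normrEsg normr_gt0.
by apply: contraTneq => ->; rewrite dot0r ltxx.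
Qed.

Definition vertex S v := (v != 0) && (#|zset S v| == d).

Lemma exists_vertex S x : (d < #|S|)%N -> x != 0 -> exists2 v, vertex S v & cell S x v.
Proof.
move=> dS; have [k] := ubnP (d - #|zset S x|)%N; elim: k x => // k IH x lek x0.
have := zset_leq S x0; rewrite leq_eqVlt => /orP[e|lt].
  by exists x; rewrite ?cell_refl // /vertex x0.
have [y y0 [c lt']] := cell_move dS x0 lt.
have [|v vS cv] := IH y _ y0; first lia.
by exists v => //; apply: cell_trans c cv.
Qed.

(** Moving away from a vertex [v] of the face keeps tight hyperplanes tight and approaches every
    hyperplane missing [v], because [x] lies on the same side of it as [v]. Arrival at [0] would
    make [x] a multiple of [v], with [d] zeros. *)
Lemma vertex_shoot S x v : (d < #|S|)%N -> x != 0 -> (#|zset S x| < d)%N ->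
  vertex S v -> cell S x v ->
  exists s, [/\ 0 < s, x - s *: v != 0, cell S x (x - s *: v)
              & (#|zset S x| < #|zset S (x - s *: v)|)%N].
Proof.
move=> dS x0 zx /andP[v0 /eqP zv] c.
have [] := @ray_exit S x (- v).
- move=> h /(subsetP (cell_zset c)); rewrite inE => /andP[_ /eqP e].
  by rewrite dotNr e oppr0.
- have [h hS hv] := exists_nonzero dS v0; exists h => //.
  have := (cellP _ _ _ c) h hS; rewrite compatE (negPf hv) /= => /andP[hx /eqP sg].
  rewrite dotNr mulrN oppr_lt0 [dot (q h) x]numEsg [dot (q h) v]numEsg sg mulrACA -expr2.
  by apply: mulr_gt0; rewrite ?exprn_even_gt0 /= ?sgr_eq0 // mulr_gt0 ?normr_gt0.
move=> s s0; rewrite scalerN => -[c' /proper_card lt]; exists s; split=> //.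
apply: contraTneq zx => /eqP; rewrite subr_eq0 => /eqP ->.
by rewrite zsetZ ?gt_eqF // zv ltnn.
Qed.

(* Conic combinations are expressed dually: every functional that is nonnegative on [zs] is nonnegative at [x]. *)
Lemma cell_decomposition S x : (d < #|S|)%N -> x != 0 ->
  exists zs, [/\ (size zs + #|zset S x| <= d.+1)%N, all (vertex S) zs, all (cell S x) zs
    & forall w, all (fun z => 0 <= dot z w) zs -> 0 <= dot x w].
Proof.
move=> dS; have [k] := ubnP (d - #|zset S x|)%N; elim: k x => // k IH x lek x0.
have := zset_leq S x0; rewrite leq_eqVlt => /orP[e|lt].
  exists [:: x]; split=> /=; rewrite ?cell_refl //; first by rewrite (eqP e).
    by rewrite /vertex x0 e.
  by move=> w /andP[].
have [v vS cv] := exists_vertex dS x0.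
have [s [s0 y0 cy lty]] := vertex_shoot dS x0 lt vS cv.
have [|zs [szs vzs czs fzs]] := IH _ _ y0; first lia.
exists (v :: zs); split=> /=; rewrite ?vS ?cv //; first lia.
  by apply: sub_all czs => z; apply: cell_trans.
move=> w /andP[vw /fzs]; rewrite dotBl dotZl => h.
by rewrite -(subrK (s * dot v w) (dot x w)) addr_ge0 // mulr_ge0 // ltW.
Qed.

(** By [gp] a hyperplane [h] outside [T] contains neither vector. The combination [u] of both that
    vanishes on [h] has [d+1] zeros, hence is [0]. *)
Lemma vertex_unique S T z y : (d < #|S|)%N -> #|T| = d -> z != 0 -> y != 0 ->
  T \subset zset S z -> T \subset zset S y -> exists2 c, c != 0 & y = c *: z.
Proof.
move=> dS Td z0 y0 Tz Ty.
have [h hS hT] : exists2 h, h \in S & h \notin T.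
  by apply/subsetPn; apply: contraL dS => /subset_leq_card; rewrite Td -leqNgt.
have notz w : w != 0 -> T \subset zset S w -> dot (q h) w != 0.
  move=> w0 Tw; apply/negP => hw; have := zset_leq S w0.
  rewrite leqNgt -Td => /negP; apply; apply: proper_card; apply/properP; split=> //.
  by exists h => //; rewrite inE hS.
pose u := dot (q h) z *: y - dot (q h) y *: z.
have u0 : u = 0.
  apply/eqP; apply: contraT => un0; have := zset_leq S un0.
  rewrite leqNgt -Td => /negP[]; apply: proper_card; apply/properP; split.
    apply/subsetP => k kT; have := subsetP Tz _ kT; have := subsetP Ty _ kT.
    rewrite !inE => /andP[-> /eqP ky] /andP[_ /eqP kz].
    by rewrite dotBr !dotZr ky kz !mulr0 subrr eqxx.
  by exists h => //; rewrite inE hS /= dotBr !dotZr mulrC subrr.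
exists (dot (q h) y / dot (q h) z); first by rewrite mulf_neq0 ?invr_eq0 ?notz.
rewrite mulrC -scalerA; move/eqP: u0; rewrite subr_eq0 => /eqP <-.
by rewrite scalerA mulVf ?notz // scale1r.
Qed.

(* [B] plays the role of a bounding simplex: [bsum] normalizes the rays of its cone. *)
Variable B : {set H}.
Hypothesis Bd : (d < #|B|)%N.

Definition bsum := \sum_(h in B) q h.
Definition inbox x := (x != 0) && [forall h in B, 0 <= dot (q h) x].

Lemma inbox_gt0 x : inbox x -> 0 < dot bsum x.
Proof.
case/andP=> x0 /forall_inP xB; have [h hB hx] := exists_nonzero Bd x0.
rewrite dot_suml (bigD1 h) //= ltr_wpDr //; last by rewrite lt_def hx xB.
by apply: sumr_ge0 => k /andP[kB _]; apply: xB.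
Qed.

Lemma inbox_cell S x y : B \subset S -> inbox x -> y != 0 -> cell S x y -> inbox y.
Proof.
move=> /subsetP BS /andP[_ /forall_inP xB] y0 /cellP c; rewrite /inbox y0.
by apply/forall_inP => h hB; apply: compat_ge0 (c h (BS h hB)) (xB h hB).
Qed.

Lemma bsum1_neq0 v : dot bsum v = 1 -> v != 0.
Proof. by apply: contra_eq_neq => ->; rewrite dot0r eq_sym oner_eq0. Qed.

(** Normalized vertices are determined by their zero sets, so there are finitely many and some [l]
    separates them. It is chosen for the full arrangement, so that one order serves all samples. *)
Lemma exists_vertex_order : exists (l : 'rV[R]_d.+1) (vtx : {set H} -> 'rV[R]_d.+1),
  (forall v, dot bsum v = 1 -> #|zset setT v| = d -> v = vtx (zset setT v)) /\
  (forall v w, dot bsum v = 1 -> dot bsum w = 1 -> #|zset setT v| = d -> #|zset setT w| = d ->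
    dot l v = dot l w -> v = w).
Proof.
pose P T v := dot bsum v = 1 /\ zset setT v = T.
(* Sets that are not the zero set of a normalized point get the default [0]. *)
pose vtx T : 'rV[R]_d.+1 := if pselect (exists v, P T v) is left e then projT1 (cid e) else 0.
have vtxE v : dot bsum v = 1 -> #|zset setT v| = d -> v = vtx (zset setT v).
  move=> bv zv; rewrite /vtx; case: pselect => [e|[]]; last by exists v.
  case: (cid e) => w [/= bw zw].
  have [|||c c0 vE] := @vertex_unique setT (zset setT v) w v _ zv (bsum1_neq0 bw) (bsum1_neq0 bv).
  - by rewrite (leq_trans Bd) // subset_leq_card // subsetT.
  - by rewrite zw.
  - by [].
  by move: bv; rewrite vE dotZr bw mulr1 => ->; rewrite scale1r.
have [l lP] := exists_separating_functional vtx; exists l, vtx; split=> // v w bv bw zv zw e.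
by rewrite (vtxE v) // (vtxE w) //; apply: lP; rewrite -!vtxE.
Qed.

Variables (l : 'rV[R]_d.+1) (vtx : {set H} -> 'rV[R]_d.+1).
Hypothesis vtxE : forall v, dot bsum v = 1 -> #|zset setT v| = d -> v = vtx (zset setT v).
Hypothesis lsep : forall v w, dot bsum v = 1 -> dot bsum w = 1 ->
  #|zset setT v| = d -> #|zset setT w| = d -> dot l v = dot l w -> v = w.

Lemma zset_setT S v : v != 0 -> #|zset S v| = d -> zset setT v = zset S v.
Proof.
move=> v0 zv; apply/esym/eqP; rewrite eqEcard zv zset_leq // andbT.
by apply/subsetP => h; rewrite !inE => /andP[].
Qed.

(** Minimality is required against all normalized points of the face, not only its vertices, because
    [isbot_sub] compares [v] with points that need not be vertices. *)
Definition isbot S x v := [/\ cell S x v, #|zset S v| = d, dot bsum v = 1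
  & forall w, cell S x w -> dot bsum w = 1 -> dot l v <= dot l w].

Lemma isbot_uniq S x v w : isbot S x v -> isbot S x w -> v = w.
Proof.
case=> cv zv bv mv [cw zw bw mw].
apply: lsep => //; rewrite ?(zset_setT (bsum1_neq0 _) zv) ?(zset_setT (bsum1_neq0 _) zw) //.
by apply: le_anti; rewrite mv ?mw.
Qed.

Lemma vertex_normalize S x v : B \subset S -> inbox x -> vertex S v -> cell S x v ->
  let v' := (dot bsum v)^-1 *: v in [/\ dot bsum v' = 1, #|zset S v'| = d & cell S x v'].
Proof.
move=> BS bx /andP[v0 /eqP zv] cv v'; have b0 := inbox_gt0 (inbox_cell BS bx v0 cv).
split; first by rewrite dotZr mulVf // gt_eqF.
  by rewrite zsetZ // invr_eq0 gt_eqF.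
by apply: cellZ => //; rewrite invr_ge0 ltW.
Qed.

Lemma isbot_exists S x : B \subset S -> inbox x -> exists v, isbot S x v.
Proof.
move=> BS bx; have x0 : x != 0 by case/andP: bx.
have dS : (d < #|S|)%N by apply: leq_trans Bd (subset_leq_card BS).
pose cand T := [&& cell S x (vtx T), #|zset S (vtx T)| == d & dot bsum (vtx T) == 1].
have candP v : dot bsum v = 1 -> #|zset S v| = d -> cell S x v ->
    v = vtx (zset setT v) /\ cand (zset setT v).
  move=> bv zv cv; rewrite /cand -vtxE //; first by rewrite cv zv bv !eqxx.
  by rewrite (zset_setT (bsum1_neq0 bv) zv).
have [v vv cv] := exists_vertex dS x0.
have [bv' zv' cv'] := vertex_normalize BS bx vv cv.
have [_ c0] := candP _ bv' zv' cv'.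
case: (Order.TotalTheory.arg_minP (fun T => dot l (vtx T)) c0) => T /and3P[cT /eqP zT /eqP bT] Tmin.
exists (vtx T); split=> // w cw bw.
have w0 := bsum1_neq0 bw; have bw' := inbox_cell BS bx w0 cw.
have [zs [_ vzs czs fzs]] := cell_decomposition dS w0.
(* In homogeneous form the inequality says that [l - dot l (vtx T) *: bsum] is nonnegative at [w];
   by [cell_decomposition] it suffices to check this at vertices, where [vtx T] is minimal. *)
have := fzs (l - dot l (vtx T) *: bsum); rewrite dotBr dotZr !(dotC w) bw mulr1 subr_ge0.
apply; apply/allP => z zzs.
have vz := allP vzs _ zzs; have cz := allP czs _ zzs.
have [bz' zz' cz'] := vertex_normalize BS bx vz (cell_trans cw cz).
have bz : 0 < dot bsum z.
  by apply/inbox_gt0/(inbox_cell BS bw' _ cz); case/andP: vz.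
have [e /Tmin] := candP _ bz' zz' cz'; rewrite -e dotZr mulrC ler_pdivlMr // => le.
by rewrite dotBr dotZr !(dotC z) subr_ge0.
Qed.

(** Dropping hyperplanes that miss [v] enlarges the face only away from [v]. If the larger face had
    a lower point [w], then points of the segment from [v] to [w] close to [v] would lie in the old
    face and be lower than [v]. *)
Lemma isbot_sub S' S x v : S' \subset S -> B \subset S' -> inbox x ->
  zset S v \subset S' -> isbot S x v -> isbot S' x v.
Proof.
move=> sS BS' bx zS' [cv zv bv mv]; split=> //; first exact: cellS cv.
  by rewrite (zsetS sS zS').
move=> w cw bw; rewrite leNgt; apply/negP => lt.
have [e e0 eP] : exists2 e, 0 < e < 1 & forall h, h \in S -> h \notin S' ->
    0 <= dot (q h) v * ((1 - e) * dot (q h) v + e * dot (q h) w).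
  (* [M] bounds the ratio of the values at [w] and [v] on each dropped hyperplane, so weight
     [1 / (M + 2)] on [w] cannot change the sign. *)
  pose M := \sum_h `|dot (q h) w| / `|dot (q h) v|.
  have M0 : 0 <= M by apply: sumr_ge0 => h _; rewrite divr_ge0.
  have M2 : 0 < M + 2 by lra.
  exists (M + 2)^-1; first by rewrite invr_gt0 M2 invf_lt1 //; lra.
  move=> h hS hS'; have v0 : dot (q h) v != 0.
    by apply: contraNneq hS' => e0; apply: (subsetP zS'); rewrite inE hS e0 eqxx.
  have le : `|dot (q h) w| / `|dot (q h) v| <= M.
    by rewrite /M (bigD1 h) //= lerDl sumr_ge0 // => k _; rewrite divr_ge0.
  rewrite ler_pdivrMr ?normr_gt0 // in le.
  set a := dot (q h) v in v0 le *; set b := dot (q h) w in le *.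
  have -> : a * ((1 - (M + 2)^-1) * a + (M + 2)^-1 * b) = (M + 2)^-1 * ((M + 1) * a ^+ 2 + a * b).
    by field; rewrite gt_eqF.
  rewrite mulr_ge0 ?invr_ge0 ?(ltW M2) //.
  have : - (a * b) <= M * a ^+ 2.
    apply: le_trans (ler_norm _) _; rewrite normrN normrM -real_normK ?num_real //.
    by rewrite expr2 mulrA mulrC ler_wpM2r.
  by have := sqr_ge0 a; nra.
pose p := (1 - e) *: v + e *: w.
have cp : cell S x p.
  apply/cellP => h hS; rewrite dotDr !dotZr; case/andP: e0 => e0 e1.
  have [hS'|hS'] := boolP (h \in S').
    by apply: compatD; apply: compatZ; rewrite ?subr_ge0 ?(ltW e0) ?(ltW e1) //;
      [exact: (cellP _ _ _ cv) | exact: (cellP _ _ _ cw)].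
  apply: compat_trans ((cellP _ _ _ cv) h hS) _.
  rewrite /compat eP //=; apply/implyP => h0.
  by case/negP: hS'; apply: (subsetP zS'); rewrite inE hS.
have bp : dot bsum p = 1 by rewrite dotDr !dotZr bv bw; ring.
have := mv p cp bp; rewrite dotDr !dotZr; case/andP: e0 => e0 e1; nra.
Qed.

(* [vs] spans the simplex containing [x] of the bottom-vertex triangulation: the ray from the bottom vertex [v]
   of the face of [x] through [x] leaves this face at [x - s *: v] (in homogeneous coordinates), where the
   construction continues. [Ts] lists the zero sets of the successive exit points. *)
Inductive chain S : 'rV[R]_d.+1 -> seq {set H} -> seq 'rV[R]_d.+1 -> Prop :=
| chain_last x v : #|zset S x| = d -> isbot S x v -> chain S x [:: zset S x] [:: v]
| chain_step x v s Ts vs : (#|zset S x| < d)%N -> isbot S x v -> 0 < s ->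
    x - s *: v != 0 -> cell S x (x - s *: v) ->
    (#|zset S x| < #|zset S (x - s *: v)%R|)%N ->
    chain S (x - s *: v) Ts vs -> chain S x (zset S x :: Ts) (v :: vs).

Lemma chain_exists S x : B \subset S -> inbox x -> exists Ts vs, chain S x Ts vs.
Proof.
move=> BS; have dS : (d < #|S|)%N by apply: leq_trans Bd (subset_leq_card BS).
have [k] := ubnP (d - #|zset S x|)%N; elim: k x => // k IH x lek bx.
have x0 : x != 0 by case/andP: bx.
have [v vb] := isbot_exists BS bx.
have := zset_leq S x0; rewrite leq_eqVlt => /orP[/eqP e|lt].
  by exists [:: zset S x], [:: v]; apply: chain_last.
case: (vb) => cv zv bv _.
have [|s [s0 y0 cy lty]] := vertex_shoot dS x0 lt _ cv.
  by rewrite /vertex (bsum1_neq0 bv) zv eqxx.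
have [||Ts [vs c]] := IH (x - s *: v); [lia | exact: inbox_cell cy|].
by exists (zset S x :: Ts), (v :: vs); apply: chain_step c.
Qed.

(** Beyond the exit point the hyperplane gained there has changed its sign. Hence the exit parameter
    is unique, and with it the chain. *)
Lemma shoot_le S x v s t : 0 < s -> (#|zset S x| < #|zset S (x - s *: v)%R|)%N ->
  cell S x (x - t *: v) -> t <= s.
Proof.
move=> s0 lt /cellP c; rewrite leNgt; apply/negP => st.
have : ~~ (zset S (x - s *: v) \subset zset S x).
  by apply: contraL lt => /subset_leq_card; rewrite -leqNgt.
case/subsetPn => h; rewrite !inE => /andP[hS /eqP hs]; rewrite hS /= => hx.
have := c h hS; rewrite /compat (negPf hx) andbT dotBr dotZr.
move/eqP: hs; rewrite dotBr dotZr subr_eq0 => /eqP hs.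
have v0 : dot (q h) v != 0 by apply: contraNneq hx => v0; rewrite hs v0 mulr0.
rewrite hs -mulrBl mulrACA -expr2 leNgt => /negP; apply.
by rewrite pmulr_llt0 ?exprn_even_gt0 // pmulr_rlt0 // subr_lt0.
Qed.

Lemma chain_inv S x Ts vs : chain S x Ts vs -> exists v us Us,
  [/\ vs = v :: us, Ts = zset S x :: Us, isbot S x v
    & (#|zset S x| = d /\ us = [::] /\ Us = [::]) \/
      (exists2 s, (#|zset S x| < d)%N /\ 0 < s &
        [/\ x - s *: v != 0, cell S x (x - s *: v),
            (#|zset S x| < #|zset S (x - s *: v)%R|)%N & chain S (x - s *: v) Us us])].
Proof.
case=> {x Ts vs}[x v zx vb|x v s Ts vs zx vb s0 y0 c lt ch].
  by exists v, [::], [::]; split=> //; left.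
by exists v, vs, Ts; split=> //; right; exists s.
Qed.

Lemma chain_uniq S x Ts vs Ts' vs' : chain S x Ts vs -> chain S x Ts' vs' -> vs = vs'.
Proof.
move=> c; elim: c Ts' vs' => {x Ts vs}[y v zy vb|y v s Ts vs zy vb s0 y0 cy lty _ IH] Ts' vs';
  case/chain_inv => u [us [Us [-> _ ub]]]; have -> := isbot_uniq ub vb; case.
- by case=> _ [->].
- by case=> t [lt _] _; move: lt; rewrite zy ltnn.
- by case=> e; move: zy; rewrite e ltnn.
- case=> t [_ t0] [_ cy' lt' ch'].
  have es : t = s by apply: le_anti; rewrite (shoot_le s0 lty cy') (shoot_le t0 lt' cy).
  by rewrite es in ch'; rewrite (IH _ _ ch').
Qed.

Lemma chain_size S x Ts vs : chain S x Ts vs ->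
  [/\ size Ts = size vs, (0 < size vs)%N & (size vs + #|zset S x| <= d.+1)%N].
Proof.
elim=> {x Ts vs}[x v zx _|x v s Ts vs zx _ _ _ _ lt _ [e _ IH]] /=; split; rewrite ?e //; clear Bd; lia.
Qed.

Lemma chain_cell S x Ts vs : chain S x Ts vs ->
  {in vs, forall v, cell S x v /\ #|zset S v| = d}.
Proof.
elim=> {x Ts vs}[x v zx [cv zv _ _]|x v s Ts vs zx [cv zv _ _] _ _ c _ _ IH] u.
  by rewrite inE => /eqP->.
rewrite inE => /orP[/eqP->//|/IH[cu zu]].
by split=> //; apply: cell_trans c cu.
Qed.

(** Dually, [x] lies in the cone over [vs]: each step writes it as [(x - s *: v) + s *: v], and the
    last point is a positive multiple of its vertex. *)
Lemma chain_farkas S x Ts vs : B \subset S -> inbox x -> chain S x Ts vs ->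
  forall w, all (fun v => 0 <= dot v w) vs -> 0 <= dot x w.
Proof.
move=> BS bx c w; elim: c bx => {x Ts vs}[x v zx [cv zv bv _]|x v s Ts vs zx _ s0 y0 c _ _ IH] bx /=.
  have dS : (d < #|S|)%N by apply: leq_trans Bd (subset_leq_card BS).
  have x0 : x != 0 by case/andP: bx.
  have [k _ xE] := vertex_unique dS zx (bsum1_neq0 bv) x0 (cell_zset cv) (subxx _).
  have kb : k = dot bsum x by rewrite xE dotZr bv mulr1.
  by rewrite xE dotZl andbT => vw; rewrite mulr_ge0 // kb ltW ?inbox_gt0.
case/andP=> vw /IH; rewrite (inbox_cell BS bx y0 c) dotBl dotZl => /(_ isT) h.
by rewrite -(subrK (s * dot v w) (dot x w)) addr_ge0 // mulr_ge0 // ltW.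
Qed.

(** The simplex depends only on the box and the hyperplanes through its vertices: these contain the
    zero sets of all points of the chain, and the bottom vertices persist by [isbot_sub]. This makes
    backward analysis possible. *)
Lemma chain_local S' S x Ts vs : S' \subset S -> B \subset S' -> inbox x ->
  {in vs, forall v, zset S v \subset S'} -> chain S x Ts vs -> chain S' x Ts vs.
Proof.
move=> sS BS' bx loc c.
elim: c loc bx => {x Ts vs}[x v zx vb|x v s Ts vs zx vb s0 y0 c lt ch IH] loc bx.
  have zv : zset S v \subset S' by apply: loc; rewrite mem_head.
  have [cv _ _ _] := vb.
  have zE := zsetS sS (subset_trans (cell_zset cv) zv).
  by rewrite -zE; apply: chain_last; [rewrite zE | apply: isbot_sub vb].
have zv : zset S v \subset S' by apply: loc; rewrite mem_head.
have [cv _ _ _] := vb.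
have zE := zsetS sS (subset_trans (cell_zset cv) zv).
have zE' : zset S' (x - s *: v) = zset S (x - s *: v).
  apply: zsetS => //; have [_ sz _] := chain_size ch.
  case: vs sz ch loc {IH} => // u vs _ ch loc.
  have [cu _] := chain_cell ch (mem_head _ _).
  by apply: subset_trans (cell_zset cu) (loc u _); rewrite !inE eqxx orbT.
rewrite -zE; apply: (@chain_step _ _ _ s); rewrite ?zE ?zE' //.
- exact: isbot_sub vb.
- exact: cellS c.
- apply: IH; first by move=> u us; apply: loc; rewrite inE us orbT.
  by apply: inbox_cell y0 c => //; apply: subset_trans sS.
Qed.

Definition crosses (f : 'rV[R]_d.+1) (vs : seq 'rV[R]_d.+1) :=
  has (fun v => 0 < dot f v) vs && has (fun v => dot f v < 0) vs.

Lemma chain_not_crosses S x Ts vs h : h \in S -> chain S x Ts vs -> ~~ crosses (q h) vs.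
Proof.
move=> hS ch; apply/negP => /andP[/hasP[v vvs v_gt0] /hasP[u uvs u_lt0]].
have [/cellP/(_ h hS) cv _] := chain_cell ch vvs; have [/cellP/(_ h hS) cu _] := chain_cell ch uvs.
have [x0|x0] := leP 0 (dot (q h) x).
  by have := compat_ge0 cu x0; lra.
by have := compat_le0 cv (ltW x0); lra.
Qed.

Lemma chain_last_sub S x Ts vs : chain S x Ts vs ->
  zset S x \subset last set0 Ts /\ last set0 Ts \subset S /\ #|last set0 Ts| = d /\
  {in Ts, forall T, T \subset last set0 Ts}.
Proof.
elim=> {x Ts vs}[x v zx _|x v s Ts vs zx _ _ _ c _ ch [IH1 [IH2 [IH3 IH4]]]] /=.
  by rewrite zset_sub; do !split=> //; move=> T; rewrite inE => /eqP->.
have [eT sz _] := chain_size ch; rewrite -eT in sz; case: Ts sz {ch eT} IH1 IH2 IH3 IH4 => // T Ts _ /= IH1 IH2 IH3 IH4.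
have zl := subset_trans (cell_zset c) IH1.
by do !split=> //; move=> T'; rewrite inE => /orP[/eqP->//|/IH4].
Qed.

Lemma isbot_sg S x y v : {in S, forall h, Num.sg (dot (q h) x) = Num.sg (dot (q h) y)} ->
  isbot S x v -> isbot S y v.
Proof.
move=> e; have ec w : cell S x w = cell S y w.
  apply: eq_forallb => h; case hS : (h \in S) => //=.
  by rewrite !compatE -(sgr_eq0 (dot (q h) x)) -(sgr_eq0 (dot (q h) y)) e.
by rewrite /isbot ec; case=> *; split=> // w; rewrite -ec; auto.
Qed.

(* The zero sets along the chain and the signs of [x] on the last one determine the face of every point of
   the chain, hence all of its bottom vertices. *)
Lemma chain_code S x y Ts vs ws : B \subset S -> inbox x -> inbox y ->
  chain S x Ts vs -> chain S y Ts ws ->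
  {in last set0 Ts, forall h, Num.sg (dot (q h) x) = Num.sg (dot (q h) y)} ->
  vs = ws /\ {in S, forall h, Num.sg (dot (q h) x) = Num.sg (dot (q h) y)}.
Proof.
move=> BS bx by_ c; have dS : (d < #|S|)%N by apply: leq_trans Bd (subset_leq_card BS).
elim: c y ws bx by_ => {x Ts vs}[x v zx vb|x v s Ts vs zx vb s0 y0 c lt ch IH] y ws bx by_;
  case/chain_inv=> w [us [Us [-> [zxy eU] wb]]].
  case=> [[zy [-> _]] _|[t _ [_ _ _ ch]]]; last first.
    by have [eT sz _] := chain_size ch; rewrite -eT -eU in sz.
  have x0 : x != 0 by case/andP: bx.
  have y0 : y != 0 by case/andP: by_.
  have sgE : {in S, forall h, Num.sg (dot (q h) x) = Num.sg (dot (q h) y)}.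
    have [|k k0 yE] := vertex_unique dS zx x0 y0 (subxx _); first by rewrite zxy.
    have := inbox_gt0 by_; rewrite yE dotZr pmulr_lgt0 ?inbox_gt0 // => k_gt0 h _.
    by rewrite dotZr sgrM (gtr0_sg k_gt0) mul1r.
  by split=> //; rewrite (isbot_uniq (isbot_sg sgE vb) wb).
case=> [[zy [_ UE]] _|[t [zy t0] [u0 cu lt' chu]] sgs].
  by have [eT sz _] := chain_size ch; rewrite -eT eU UE in sz.
have [zl [_ [_ subl]]] := chain_last_sub ch.
have [eT sz _] := chain_size ch.
have lastE : last set0 (zset S x :: Ts) = last set0 Ts by rewrite -eT in sz; case: (Ts) sz.
rewrite {}lastE in sgs; rewrite -eU in chu.
have sg_cell a b : cell S a b -> {in S, forall h, dot (q h) b != 0 ->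
    Num.sg (dot (q h) a) = Num.sg (dot (q h) b)}.
  by move=> /cellP cab h hS; apply: compat_sg; apply: cab.
have zE : zset S (x - s *: v) = zset S (y - t *: w).
  by have [? [? [? [_ e1 _ _]]]] := chain_inv ch; have [? [? [? [_ e2 _ _]]]] := chain_inv chu;
     move: e2; rewrite e1 => -[].
have zEh h : h \in S -> (dot (q h) (x - s *: v) == 0) = (dot (q h) (y - t *: w) == 0).
  by move=> hS; move/setP/(_ h): zE; rewrite !inE hS.
have lS : last set0 Ts \subset S by have [_ []] := chain_last_sub ch.
have [|<- sgE] := IH (y - t *: w) us (inbox_cell BS bx y0 c) (inbox_cell BS by_ u0 cu) chu.
  move=> h hl; have hS := subsetP lS h hl.
  have [x'0|x'0] := eqVneq (dot (q h) (x - s *: v)) 0.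
    have y'0 : dot (q h) (y - t *: w) = 0 by apply/eqP; rewrite -zEh // x'0.
    by rewrite x'0 y'0.
  rewrite -(sg_cell _ _ c) // -(sg_cell _ _ cu) -?zEh //; exact: sgs.
(* A hyperplane through the exit point lies in the last zero set, where the signs agree by
   assumption; on any other one, [x] and its exit point have the same sign. *)
have sgxy : {in S, forall h, Num.sg (dot (q h) x) = Num.sg (dot (q h) y)}.
  move=> h hS; have [x'0|x'0] := eqVneq (dot (q h) (x - s *: v)) 0.
    by apply: sgs; apply: (subsetP zl); rewrite inE hS x'0 eqxx.
  by rewrite (sg_cell _ _ c) // (sg_cell _ _ cu) -?zEh // sgE.
by split=> //; rewrite (isbot_uniq (isbot_sg sgxy vb) wb).
Qed.

End Arrangement.

(** * Cuttings by random sampling *)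

Section Sampling.

Lemma cards_sum (T : finType) (P : pred T) : #|[set t | P t]| = (\sum_t (P t : nat))%N.
Proof. by rewrite -sum1_card big_mkcond; apply: eq_bigr => t _; rewrite inE; case: (P t). Qed.

Lemma card_has_leq (T : finType) (S : eqType) (F : S -> {set T}) (s : seq S) c :
  {in s, forall z, #|F z| <= c}%N -> (#|[set t | has (fun z => t \in F z) s]| <= size s * c)%N.
Proof.
elim: s => [|z s IH] sc /=; first by rewrite (eq_card0 (A := [set t | _])) // => t; rewrite inE.
have -> : [set t | (t \in F z) || has (fun z => t \in F z) s] =
          F z :|: [set t | has (fun z => t \in F z) s].
  by apply/setP => t; rewrite in_setU !in_set.
rewrite mulSn (leq_trans (leq_card_setU _ _)) // leq_add ?sc ?mem_head //.
by apply: IH => u us; rewrite sc // inE us orbT.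
Qed.

(** There are at most [#|C|] light classes, each smaller than [#|I| / (2 * #|C|)], so together they
    fill at most half of [I]. *)
Lemma card_light_class (I C : finType) (code : I -> C) :
  (#|[set i | (2 * #|C| * #|[set j | code j == code i]| < #|I|)%N]| * 2 <= #|I|)%N.
Proof.
set L := [set i | _]; have [/eqP C0|C0] := posnP #|C|.
  have I0 : #|I| = 0%N.
    apply: eq_card0 => i; have := card0_eq (eqP C0); move/(_ (code i)); by rewrite !inE.
  by have := max_card (mem L); rewrite I0; case: #|L|.
suff : (2 * #|C| * #|L| <= #|C| * #|I|)%N by nia.
have -> : #|L| = (\sum_(c : C) #|[set i in L | code i == c]|)%N.
  rewrite -sum1_card (partition_big code predT) //=; apply: eq_bigr => c _.
  by rewrite -sum1_card; apply: eq_bigl => i; rewrite inE.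
rewrite big_distrr /= -[(#|C| * _)%N]sum_nat_const; apply: leq_sum => c _.
have [->|[i]] := set_0Vmem [set i in L | code i == c]; first by rewrite cards0 muln0.
rewrite !inE => /andP[lt /eqP e]; apply: leq_trans (ltnW lt).
rewrite leq_mul2l; apply/orP; right; apply: subset_leq_card.
by apply/subsetP => j; rewrite !inE e => /andP[].
Qed.

Variables (Om : finType) (r : nat).

Definition dropn (s : {ffun 'I_r.+1 -> Om}) (a : 'I_r.+1) : {ffun 'I_r -> Om} :=
  [ffun j => s (lift a j)].

Lemma sum_dropn (F : {ffun 'I_r -> Om} -> Om -> nat) a :
  (\sum_(s : {ffun 'I_r.+1 -> Om}) F (dropn s a) (s a) =
   \sum_(s : {ffun 'I_r -> Om}) \sum_(o : Om) F s o)%N.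
Proof.
rewrite pair_big /= (reindex (fun s : {ffun 'I_r.+1 -> Om} => (dropn s a, s a))) //=.
exists (fun p : {ffun 'I_r -> Om} * Om =>
          [ffun j => if unlift a j is Some k then p.1 k else p.2]) => [s _|[s o] _].
  by apply/ffunP => j; rewrite ffunE; case: unliftP => [k|] ->; rewrite ?ffunE.
congr (_, _); last by rewrite ffunE unlift_none.
by apply/ffunP => j; rewrite !ffunE liftK.
Qed.

(* Backward analysis: an [r]-sample followed by a further random element is an [r+1]-sample with a random
   index marked. *)
Lemma exists_few_conflicts (I : finType) (cr : {ffun 'I_r -> Om} -> I -> Om -> bool)
    (light : {ffun 'I_r -> Om} -> I -> bool) (D : nat) :
  (0 < #|Om|)%N -> (0 < #|I|)%N ->
  (forall s i, #|[set a | cr (dropn s a) i (s a)]| <= D)%N ->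
  (forall s, #|[set i | light s i]| * 2 <= #|I|)%N ->
  exists s i, ~~ light s i /\ (#|[set o | cr s i o]| * r.+1 <= 2 * D * #|Om|)%N.
Proof.
move=> Om0 I0 crD lightP; apply: contrapT => no.
have {}no s i : ~~ light s i -> (2 * D * #|Om| < #|[set o | cr s i o]| * r.+1)%N.
  by move=> li; rewrite ltnNge; apply/negP => le; apply: no; exists s, i.
pose N s i := #|[set o | cr s i o]|.
(* Double counting over [r+1]-samples with a marked index: each sample and [i] contribute at most
   [D] conflicts. *)
have up : (r.+1 * \sum_s \sum_i N s i <= #|Om| ^ r.+1 * (#|I| * D))%N.
  have -> : (r.+1 * \sum_s \sum_i N s i =
      \sum_(s : {ffun 'I_r.+1 -> Om}) \sum_i #|[set a | cr (dropn s a) i (s a)]|)%N.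
    have E i : (\sum_(s : {ffun 'I_r.+1 -> Om}) #|[set a | cr (dropn s a) i (s a)]| =
                r.+1 * \sum_s N s i)%N.
      under [LHS]eq_bigr => s _ do rewrite (cards_sum (fun a => cr (dropn s a) i (s a))).
      rewrite [LHS]exchange_big /=.
      under [LHS]eq_bigr => a _ do rewrite (sum_dropn (fun s o => cr s i o : nat) a).
      rewrite sum_nat_const card_ord; congr (_ * _)%N; apply: eq_bigr => s _.
      by rewrite /N (cards_sum (fun o => cr s i o)).
    rewrite [in LHS]exchange_big [RHS]exchange_big /= big_distrr /=.
    by apply: eq_bigr => i _; rewrite E.
  have -> : (#|Om| ^ r.+1 = #|{: {ffun 'I_r.+1 -> Om}}|)%N by rewrite card_ffun card_ord.
  rewrite -sum_nat_const; apply: leq_sum => s _.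
  by rewrite -sum_nat_const; apply: leq_sum => i _; apply: crD.
(* The non-light [i] make up at least half of [I], and by assumption each of them has too many
   conflicts. *)
have low : (#|Om| ^ r * ((2 * D * #|Om|).+1 * #|I|) <= 2 * (r.+1 * \sum_s \sum_i N s i))%N.
  have -> : (#|Om| ^ r = #|{: {ffun 'I_r -> Om}}|)%N by rewrite card_ffun card_ord.
  rewrite -sum_nat_const mulnA big_distrr /=; apply: leq_sum => s _.
  have hv : (#|I| <= 2 * #|[set i | ~~ light s i]|)%N.
    have := lightP s; have := cardsC [set i | light s i].
    have -> : ~: [set i | light s i] = [set i | ~~ light s i] by apply/setP => i; rewrite !inE.
    lia.
  have : ((2 * D * #|Om|).+1 * #|[set i | ~~ light s i]| <= r.+1 * \sum_i N s i)%N.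
    rewrite -sum1_card !big_distrr /= big_mkcond /=; apply: leq_sum => i _.
    by rewrite inE; case: ifP => // /no lt; rewrite muln1 [(r.+1 * _)%N]mulnC.
  move=> le; apply: leq_trans (leq_mul (leqnn _) hv) _.
  by rewrite mulnCA -[(_ * r.+1 * _)%N]mulnA leq_mul2l le.
have Or : (0 < #|Om| ^ r)%N by rewrite expn_gt0 Om0.
move: up low; rewrite expnS; set P := (#|Om| ^ r)%N in Or *.
set W := (r.+1 * _)%N; nia.
Qed.

End Sampling.

(* Bounds the number of simplices in the triangulation of a sample of size [r], by [chain_code]. *)
Definition ncodes d r := ((r + d.+1) ^ d * (2 ^ d) ^ d.+1 * 2 ^ d * d.+2)%N.

Section Cutting.
Variables (R : realFieldType) (d : nat) (H : finType) (q : H -> 'rV[R]_d.+1).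
Hypothesis gp : forall x, x != 0 -> (#|[set h | dot (q h) x == 0%R]| <= d)%N.
Variable beta : 'I_d.+1 -> H.
Hypothesis beta_inj : injective beta.
Let B := [set beta j | j : 'I_d.+1].

Let Bd : (d < #|B|)%N.
Proof. by rewrite card_imset // card_ord. Qed.

(** The code consists of indices of the [d] hyperplanes of the last zero set, all zero sets of the
    chain as subsets of these, the hyperplanes among them on which [x] is positive, and the length
    of the chain. Zero values are recognized from the first zero set. *)
Lemma exists_chain_code (l : 'rV[R]_d.+1) (I J : finType) (x : I -> 'rV[R]_d.+1) (idx : J -> H)
    (Ts : I -> seq {set H}) (vs : I -> seq 'rV[R]_d.+1) :
  (forall v w, dot (bsum q B) v = 1 -> dot (bsum q B) w = 1 ->
    #|zset q setT v| = d -> #|zset q setT w| = d -> dot l v = dot l w -> v = w) ->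
  B \subset [set idx j | j : J] -> (forall i, inbox q B (x i)) ->
  (forall i, chain q B l [set idx j | j : J] (x i) (Ts i) (vs i)) ->
  exists code : I -> {ffun 'I_d -> J} * {ffun 'I_d.+1 -> {set 'I_d}} * {set 'I_d} * 'I_d.+2,
    forall i j, code i = code j -> vs i = vs j.
Proof.
set S := [set idx j | j : J] => lsep BS bx ch.
pose P i (c : {ffun 'I_d -> J} * {ffun 'I_d.+1 -> {set 'I_d}} * {set 'I_d} * 'I_d.+2) :=
  let: (e, tau, sg, k) := c in
  [/\ Ts i = [seq [set idx (e a) | a in tau (inord n)] | n <- iota 0 k],
      last set0 (Ts i) \subset [set idx (e a) | a : 'I_d]
    & forall a, (a \in sg) = (0 < dot (q (idx (e a))) (x i))].
have exc i : exists c, P i c.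
  have [szT _ szle] := chain_size (ch i); rewrite -szT in szle.
  have [_ [lS [ld sub]]] := chain_last_sub (ch i).
  set L := last set0 (Ts i) in lS ld sub *.
  have ex (a : 'I_d) : exists j, idx j = enum_val (cast_ord (esym ld) a).
    have := subsetP lS _ (enum_valP (cast_ord (esym ld) a)).
    by case/imsetP => j _ ->; exists j.
  have [e eP] := choice ex.
  have LE : L \subset [set idx (e a) | a : 'I_d].
    apply/subsetP => h hL; apply/imsetP; exists (cast_ord ld (enum_rank_in hL h)) => //.
    by rewrite eP cast_ordK enum_rankK_in.
  have szk : (size (Ts i) < d.+2)%N by lia.
  exists ([ffun a => e a], [ffun n : 'I_d.+1 => [set a | idx (e a) \in nth set0 (Ts i) n]],
          [set a | 0 < dot (q (idx (e a))) (x i)], Ordinal szk); split=> /=.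
  - apply: (@eq_from_nth _ set0) => [|n nT]; first by rewrite size_map size_iota.
    rewrite (nth_map 0%N) ?size_iota // nth_iota // add0n.
    apply/setP => h; apply/idP/imsetP => [hT|[a]].
      have /imsetP[a _ ha] : h \in [set idx (e a) | a : 'I_d].
        by apply: (subsetP LE); exact: (subsetP (sub _ (mem_nth set0 nT)) h hT).
      exists a; last by rewrite ffunE.
      by rewrite ffunE inE inordK -?ha //; lia.
    by rewrite !ffunE inE inordK; [move=> + ->|lia].
  - by apply: subset_trans LE _; apply/subsetP => h /imsetP[a _ ->]; apply/imsetP; exists a; rewrite ?ffunE.
  - by move=> a; rewrite inE ffunE.
have [code codeP] := choice exc; exists code => i j e.
have := codeP i; have := codeP j; rewrite e.
case: (code j) => [[[f tau] sg] k] [Tj _ sj] [Ti Li si].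
have Tij : Ts i = Ts j by rewrite Ti Tj.
have chj := ch j; rewrite -Tij in chj.
have zE : zset q S (x i) = zset q S (x j).
  have [? [? [? [_ e1 _ _]]]] := chain_inv (ch i).
  by have [? [? [? [_ e2 _ _]]]] := chain_inv chj; move: e2; rewrite e1 => -[].
have [] // := chain_code gp Bd lsep BS (bx i) (bx j) (ch i) chj.
move=> h hl; have [_ [/subsetP/(_ h hl) hS _]] := chain_last_sub (ch i).
have /imsetP[a _ ha] := subsetP Li h hl.
have [xi0|xi0] := eqVneq (dot (q h) (x i)) 0.
  by move/setP/(_ h): zE; rewrite !inE hS xi0 eqxx => /esym/eqP->.
have xj0 : dot (q h) (x j) != 0 by move/setP/(_ h): zE; rewrite !inE hS (negPf xi0) => /esym/negbT.
have sE : (0 < dot (q h) (x i)) = (0 < dot (q h) (x j)) by rewrite ha -si -sj.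
have [lt|lt|eq0] := ltrgt0P (dot (q h) (x j)); last by rewrite eq0 eqxx in xj0.
  by rewrite !gtr0_sg // sE.
by rewrite !ltr0_sg // lt_neqAle xi0 leNgt sE -leNgt ltW.
Qed.

(** The multiset [p] stands for a distribution on hyperplanes and [beta] for a simplex around all
    points. [Y] is a class of points sharing one simplex in the triangulation of a sample. *)
Lemma exists_cutting (I Om : finType) (x : I -> 'rV[R]_d.+1) (p : Om -> H) (r : nat) :
  (forall i j, 0 < dot (q (beta j)) (x i)) -> (0 < #|Om|)%N -> (0 < #|I|)%N ->
  exists (vs : seq 'rV[R]_d.+1) (Y : {set I}),
  [/\ (0 < size vs <= d.+1)%N, (#|I| <= 2 * ncodes d r * #|Y|)%N,
      forall i, i \in Y -> forall w, all (fun v => 0 <= dot v w) vs -> 0 <= dot (x i) w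
    & (#|[set o | crosses (q (p o)) vs]| * r.+1 <= 2 * (d.+1 ^ 2) * #|Om|)%N].
Proof.
move=> xpos Om0 I0.
have bx i : inbox q B (x i).
  apply/andP; split; last by apply/forall_inP => h /imsetP[j _ ->]; apply/ltW/xpos.
  by apply: contraTneq (xpos i ord0) => ->; rewrite dot0r ltxx.
have [l [vtx [vtxE lsep]]] := exists_vertex_order gp Bd.
have exch (Si : {set H} * I) : exists c : seq {set H} * seq 'rV[R]_d.+1,
    B \subset Si.1 -> chain q B l Si.1 (x Si.2) c.1 c.2.
  have [BS|BS] := boolP (B \subset Si.1); last by exists ([::], [::]).
  have [Ts [vs c]] := chain_exists gp Bd l vtxE BS (bx Si.2).
  by exists (Ts, vs).
have [sel selP] := choice exch.
pose idx k (s : {ffun 'I_k -> Om}) (j : 'I_k + 'I_d.+1) :=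
  match j with inl a => p (s a) | inr b => beta b end.
pose RS k (s : {ffun 'I_k -> Om}) := [set idx k s j | j : 'I_k + 'I_d.+1].
have BRS k (s : {ffun 'I_k -> Om}) : B \subset RS k s.
  by apply/subsetP => h /imsetP[j _ ->]; apply/imsetP; exists (inr j).
pose Vs s i := (sel (RS r s, i)).2.
pose cr s i o := crosses (q (p o)) (Vs s i).
have exc s : exists code : I -> {ffun 'I_d -> 'I_r + 'I_d.+1} * {ffun 'I_d.+1 -> {set 'I_d}} * {set 'I_d} * 'I_d.+2,
    forall i j, code i = code j -> Vs s i = Vs s j.
  apply: (exists_chain_code (Ts := fun i => (sel (RS r s, i)).1) lsep (BRS r s) bx) => i.
  exact: (selP (RS r s, i) (BRS r s)).
have [code codeP] := choice exc.
have cardC : #|{: {ffun 'I_d -> 'I_r + 'I_d.+1} * {ffun 'I_d.+1 -> {set 'I_d}} * {set 'I_d} * 'I_d.+2}| =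
    ncodes d r.
  by rewrite !card_prod !card_ffun card_sum !card_ord -!cardsT -!powersetT !card_powerset !cardsT card_ord.
(* By locality, omitting index [a] changes the simplex of [x i] only if the hyperplane of [a] passes
   through one of its at most [d+1] vertices, each on [d] hyperplanes. *)
have crD s i : (#|[set a | cr (dropn s a) i (s a)]| <= d.+1 ^ 2)%N.
  set S := RS r.+1 s; have ch := selP (S, i) (BRS _ s).
  set vs := (sel (S, i)).2 in ch.
  pose df := [set h | has (fun v => h \in zset q S v) vs].
  have dfle : (#|df| <= d.+1 ^ 2)%N.
    have [_ _ szle] := chain_size ch.
    apply: leq_trans (card_has_leq (c := d) _) _; first by move=> v /(chain_cell ch)[_ ->].
    by rewrite -mulnn leq_mul // ?leqnSn // (leq_trans _ szle) // leq_addr.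
  have drS a : RS r (dropn s a) \subset S.
    apply/subsetP => h /imsetP[[b|b] _ ->]; apply/imsetP; last by exists (inr b).
    by exists (inl (lift a b)); rewrite //= ffunE.
  have Sdr a h : h \in S -> h != p (s a) -> h \in RS r (dropn s a).
    case/imsetP=> [[b|b] _ ->] /= ne; apply/imsetP; last by exists (inr b).
    case: (unliftP a b) ne => [k ->|->] ne; last by rewrite eqxx in ne.
    by exists (inl k); rewrite //= ffunE.
  (* A hyperplane that is still present after omitting [a] causes no conflict; hence conflicting
     indices have distinct hyperplanes, although [p] may repeat values. *)
  have key a : cr (dropn s a) i (s a) -> p (s a) \in df /\ p (s a) \notin RS r (dropn s a).
    rewrite /cr => crs; have ch' := selP (RS r (dropn s a), i) (BRS _ _).
    split; last by apply: contraL crs => hS; apply: chain_not_crosses hS ch'.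
    apply: contraLR crs => nd; have -> : Vs (dropn s a) i = vs.
      apply: (chain_uniq gp lsep ch'); apply: chain_local (drS a) (BRS _ _) (bx i) _ ch.
      move=> v vvs; apply/subsetP => h hz; apply: Sdr; first by move: hz; rewrite inE => /andP[].
      by apply: contraNneq nd => <-; rewrite inE; apply/hasP; exists v.
    by apply: chain_not_crosses ch; apply/imsetP; exists (inl a).
  apply: leq_trans dfle; rewrite -(card_in_imset (f := fun a => p (s a))).
    by apply: subset_leq_card; apply/subsetP => h /imsetP[a]; rewrite inE => /key[? _] ->.
  move=> a b; rewrite !inE => /key[_ na] _ e; apply/eqP; apply: contraNT na => ne.
  case: (unliftP a b) e ne => [k ->|->] e; last by rewrite eqxx.
  by move=> _; rewrite e; apply/imsetP; exists (inl k); rewrite //= ffunE.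
have [s [i [hv crle]]] := @exists_few_conflicts Om r I cr
   (fun s i => 2 * #|{: {ffun 'I_d -> 'I_r + 'I_d.+1} * {ffun 'I_d.+1 -> {set 'I_d}} * {set 'I_d} * 'I_d.+2}| *
          #|[set j | code s j == code s i]| < #|I|)%N (d.+1 ^ 2) Om0 I0 crD (fun s => card_light_class (code s)).
exists (Vs s i), [set j | code s j == code s i]; split=> //.
- have [_ sz szle] := chain_size (selP (RS r s, i) (BRS r s)).
  by rewrite sz (leq_trans _ szle) // leq_addr.
- by rewrite leqNgt -cardC.
- move=> j; rewrite inE => /eqP e; rewrite -(codeP s _ _ e).
  by move=> w; apply: (chain_farkas gp Bd (BRS r s) (bx j) (selP (RS r s, j) (BRS r s))).
Qed.

End Cutting.

(** * Multiplicative weights and a counting form of the local lemma *)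

Section Multiplicative_weights.
Local Open Scope nat_scope.

Lemma expn_half_double K : (2 * K).+1 ^ K <= 2 * (2 * K) ^ K.
Proof.
(* Bernoulli's inequality [(1 - 1/(N+1))^j >= 1 - j/(N+1)] with denominators cleared. *)
have bern N j : j <= N -> N.+1 ^ j * (N.+1 - j) <= N.+1 * N ^ j.
  elim: j => [_|j IH lt]; first by rewrite !expn0 subn0 mul1n muln1.
  have := IH (ltnW lt); rewrite !expnS => le.
  have : N * (N.+1 ^ j * (N.+1 - j)) <= N.+1 * (N * N ^ j).
    by rewrite [X in _ <= X]mulnCA leq_mul2l le orbT.
  apply: leq_trans; rewrite [X in _ <= X]mulnCA -mulnA [X in X <= _]mulnCA leq_mul2l.
  by apply/orP; right; nia.
have := bern (2 * K) K; have -> : (2 * K).+1 - K = K.+1 by lia.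
by move=> /(_ ltac:(lia)) le; nia.
Qed.

(** The weight of [h] doubles whenever [h] is crossed, so each round multiplies the total weight by
    at most [1 + 1/(2K)]. After [K * L] rounds the total is at most [2^L * 2^L], which bounds every
    single weight. *)
Lemma exists_low_crossing (H : finType) (P : Type) (good : P -> Prop) (cross : P -> pred H) K :
  0 < K ->
  (forall (Om : finType) (p : Om -> H), 0 < #|Om| ->
     exists v, good v /\ #|[set o | cross v (p o)]| * (2 * K) <= #|Om|) ->
  0 < #|H| -> forall L, #|H| <= 2 ^ L ->
  exists vs : 'I_(K * L) -> P, (forall k, good (vs k)) /\
    forall h, #|[set k | cross (vs k) h]| <= 2 * L.
Proof.
move=> K0 oracle H0 L HL.
have step n : exists vs : nat -> P, (forall k, k < n -> good (vs k)) /\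
    (\sum_h 2 ^ (\sum_(k < n) cross (vs k) h)) * (2 * K) ^ n <= #|H| * (2 * K).+1 ^ n.
  elim: n => [|n [vs [gvs le]]].
    have [h0 _] : exists h : H, h \in predT by apply/card_gt0P; rewrite H0.
    have [|v _] := oracle unit (fun _ => h0); first by rewrite card_unit.
    exists (fun _ => v); split=> //; rewrite !expn0 !muln1.
    by rewrite (eq_bigr (fun _ => 1)) ?sum1_card // => h _; rewrite big_ord0.
  pose c h := \sum_(k < n) cross (vs k) h; set W := \sum_h _ in le.
  (* With [2 ^ c h] copies of each [h], the uniform distribution on [Om] realizes the weights. *)
  pose Om := {h : H & 'I_(2 ^ c h)}.
  have sumOm (F : H -> nat) : \sum_(o : Om) F (tag o) = \sum_h 2 ^ c h * F h.
    rewrite -(@sig_big_dep _ _ _ _ (fun h => 'I_(2 ^ c h)) xpredT (fun _ _ => true) (fun h _ => F h)).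
    by apply: eq_bigr => h _; rewrite sum_nat_const card_ord.
  have cOm : #|{: Om}| = W.
    by rewrite -sum1_card (sumOm (fun=> 1)); apply: eq_bigr => h _; rewrite muln1.
  have [|v [gv vle]] := oracle Om (fun o => tag o).
    rewrite cOm /W; have /card_gt0P[h _] := H0.
    by rewrite (bigD1 h) //= addn_gt0 expn_gt0.
  rewrite cOm cards_sum (sumOm (fun h => cross v h)) in vle.
  exists (fun k => if k < n then vs k else v); split.
    by move=> k; rewrite ltnS; case: ltnP => // lt _; apply: gvs.
  have -> : \sum_h 2 ^ (\sum_(k < n.+1) cross (if k < n then vs k else v) h) =
            W + \sum_h 2 ^ c h * cross v h.
    rewrite -big_split; apply: eq_bigr => h _; rewrite big_ord_recr /= ltnn.
    have -> : \sum_(i < n) cross (if i < n then vs i else v) h = c h.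
      by apply: eq_bigr => k _; rewrite ltn_ord.
    by rewrite expnD; case: (cross v h); rewrite ?expn0 ?expn1 ?muln1 ?muln0 ?addn0 // muln2 addnn.
  rewrite !expnS; set X := \sum_h 2 ^ c h * cross v h in vle *.
  set a := (2 * K) ^ n in le *; set b := (2 * K).+1 ^ n in le *.
  have e1 : (W + X) * (2 * K * a) <= W * a * (2 * K).+1.
    rewrite mulnA [_ * a]mulnC [W * a]mulnC -mulnA leq_mul2l; apply/orP; right; nia.
  by apply: leq_trans e1 _; rewrite mulnCA [X in _ <= X]mulnC leq_mul2r le orbT.
have [vs [gvs le]] := step (K * L).
exists (fun k => vs k); split=> [k|h]; first exact: gvs.
rewrite cards_sum -(leq_exp2l (m := 2)) //.
set W := \sum_h _ in le; apply: (@leq_trans W).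
  by rewrite /W (bigD1 h) //= leq_addr.
have pw : (2 * K).+1 ^ (K * L) <= 2 ^ L * (2 * K) ^ (K * L).
  by rewrite !expnM -expnMn; case: (L) => [|k]; rewrite ?expn0 // leq_exp2r // expn_half_double.
have K2 : 0 < (2 * K) ^ (K * L) by rewrite expn_gt0; lia.
have -> : 2 * L = L + L by lia.
rewrite -(leq_pmul2r K2) expnD -mulnA.
by apply: leq_trans le (leq_mul HL pw).
Qed.

End Multiplicative_weights.

Section Counting.
Local Open Scope nat_scope.
Variables (m T : nat).
Let A := {ffun 'I_m -> 'I_T}.

(** Exchanging the coordinates in [U] between two assignments is an involution that carries pairs
    with first entry in [X :&: Y] to pairs in [X] times [Y]. *)
Lemma card_indep (X Y : {set A}) (U : {set 'I_m}) :
  (forall a b : A, {in ~: U, a =1 b} -> (a \in X) = (b \in X)) ->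
  (forall a b : A, {in U, a =1 b} -> (a \in Y) = (b \in Y)) ->
  #|X :&: Y| * T ^ m = #|X| * #|Y|.
Proof.
move=> dX dY; pose mix (a b : A) : A := [ffun j => if j \in U then b j else a j].
pose f (p : A * A) := (mix p.1 p.2, mix p.2 p.1).
have finv : involutive f.
  by case=> a b; congr (_, _); apply/ffunP => j; rewrite !ffunE; case: (j \in U).
have -> : T ^ m = #|[set: A]| by rewrite cardsT card_ffun !card_ord.
rewrite -!cardsX -(card_preimset _ (inv_inj finv)); apply: eq_card => -[a b].
rewrite !inE andbT /=; congr (_ && _).
  by apply: dX => j; rewrite inE ffunE => /negPf->.
by apply: dY => j; rewrite ffunE => ->.
Qed.

(** Exchanging [a i] with an independent value [t] preserves the count, so the bound conditional on
    the other coordinates can be averaged. *)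
Lemma card_avg (P : pred A) i (Q : nat) :
  (forall a : A, #|[set t | P [ffun j => if j == i then t else a j]]| * Q <= T) ->
  #|[set a | P a]| * Q <= T ^ m.
Proof.
move=> le; pose set1 (a : A) t : A := [ffun j => if j == i then t else a j].
have [T0|T0] := posnP T.
  have -> : #|[set a | P a]| = 0 by apply: eq_card0 => a; have := ltn_ord (a i); rewrite [X in _ < X]T0.
  by [].
pose f (p : A * 'I_T) := (set1 p.1 p.2, p.1 i).
have finv : involutive f.
  case=> a t; congr (_, _); last by rewrite /= ffunE eqxx.
  by apply/ffunP => j; rewrite !ffunE; case: eqP => [->|].
have E : \sum_(a : A) #|[set t | P (set1 a t)]| = #|[set a | P a]| * T.
  under eq_bigr => a _ do rewrite (cards_sum (fun t => P (set1 a t))).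
  rewrite pair_big /=; transitivity (\sum_(p : A * 'I_T) P p.1).
    by rewrite [RHS](reindex_inj (inv_inj finv)).
  rewrite -(pair_big predT predT (fun a (_ : 'I_T) => nat_of_bool (P a))) /= cards_sum big_distrl /=.
  by apply: eq_bigr => a _; rewrite sum_nat_const card_ord mulnC.
rewrite -(leq_pmul2r T0) mulnAC -E big_distrl /=.
have -> : T ^ m = #|{: A}| by rewrite card_ffun !card_ord.
by rewrite -sum_nat_const; apply: leq_sum => a _; apply: le.
Qed.

Variables (d Q : nat) (bad : {ffun 'I_d.+1 -> 'I_m} -> A -> bool).
Hypothesis bad_dep : forall (e : {ffun 'I_d.+1 -> 'I_m}) (a b : A), (forall l, a (e l) = b (e l)) -> bad e a = bad e b.
Hypothesis bad_small : forall e : {ffun 'I_d.+1 -> 'I_m}, injective e -> #|[set a | bad e a]| * Q <= T ^ m.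
Hypothesis bad_few : 2 ^ d.+1 * (d.+1 * m ^ d) <= Q.
Hypothesis T0 : 0 < T.

Let inside (S : {set 'I_m}) (e : {ffun 'I_d.+1 -> 'I_m}) := injectiveb e && [forall l, e l \in S].
Let good (S : {set 'I_m}) := [set a | [forall e, inside S e ==> ~~ bad e a]].

Lemma goodP S a : reflect (forall e, inside S e -> ~~ bad e a) (a \in good S).
Proof. by rewrite inE; apply: (iffP forallP) => h e; apply/implyP/h. Qed.

Lemma goodS (S S' : {set 'I_m}) : S' \subset S -> good S \subset good S'.
Proof.
move=> /subsetP sS; apply/subsetP => a /goodP ga; apply/goodP => e /andP[ie /forallP eS'].
by apply: ga; rewrite /inside ie; apply/forallP => l; apply: sS.
Qed.

Lemma card_through i : #|[set e : {ffun 'I_d.+1 -> 'I_m} | [exists l, e l == i]]| <= d.+1 * m ^ d.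
Proof.
pose f (e : {ffun 'I_d.+1 -> 'I_m}) : 'I_d.+1 * {ffun 'I_d -> 'I_m} :=
  let l := odflt ord0 [pick l | e l == i] in (l, dropn e l).
have -> : d.+1 * m ^ d = #|{: 'I_d.+1 * {ffun 'I_d -> 'I_m}}|.
  by rewrite card_prod card_ffun !card_ord.
rewrite -(card_in_imset (f := f)) ?max_card // => e e'; rewrite !inE => ex ex' [].
have pickE (g : {ffun 'I_d.+1 -> 'I_m}) : [exists l, g l == i] -> g (odflt ord0 [pick l | g l == i]) = i.
  by move=> /existsP[l gl]; case: pickP => [k /eqP//|/(_ l)]; rewrite gl.
move=> el; move: (pickE _ ex) (pickE _ ex'); rewrite -el; set l := odflt _ _ => gl gl' dE.
apply/ffunP => j; case: (unliftP l j) => [k ->|->]; last by rewrite gl gl'.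
by move/ffunP/(_ k): dE; rewrite !ffunE.
Qed.

(* Counting substitute for the Lovasz local lemma: adding one index to the constrained set keeps at least half
   of the good assignments. *)
Lemma good_half (S : {set 'I_m}) i : i \notin S -> #|good S| <= 2 * #|good (i |: S)|.
Proof.
have [n] := ubnP #|S|; elim: n S i => // n IH S i Sn iS.
(* Indices are removed one at a time, each at most doubling the number of good assignments. *)
have IHs (A' : {set 'I_m}) : A' \subset S -> #|good A'| <= 2 ^ #|S :\: A'| * #|good S|.
  have [k] := ubnP #|S :\: A'|; elim: k A' => // k IHk A' lek sA'.
  have [e|/subsetPn[j jS jA']] := boolP (S \subset A').
    have -> : A' = S by apply/eqP; rewrite eqEsubset sA'.
    by rewrite setDv cards0 mul1n.
  have dE : #|S :\: A'| = #|S :\: (j |: A')|.+1.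
    by rewrite (cardsD1 j (S :\: A')) !inE jS jA' add1n setDDl setUC.
  have ltA : #|A'| < n.
    have : A' \proper S by apply/properP; split=> //; exists j.
    by move/proper_card; lia.
  have := IH A' j ltA jA'; have := IHk (j |: A').
  rewrite dE expnS -mulnA subUset sub1set jS sA' => /(_ _ isT) h h2.
  apply: leq_trans h2 _; rewrite leq_mul2l /= h //; lia.
pose E := [set e : {ffun 'I_d.+1 -> 'I_m} | inside (i |: S) e && [exists l, e l == i]].
have split_good : #|good S| <= #|good (i |: S)| + \sum_(e in E) #|good S :&: [set a | bad e a]|.
  have sub : good S \subset good (i |: S) :|: \bigcup_(e in E) (good S :&: [set a | bad e a]).
    apply/subsetP => a ga; rewrite in_setU; case: (boolP (a \in good (i |: S))) => //= ng.
    have [e /andP[ie be]] : exists e, inside (i |: S) e && bad e a.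
      apply/existsP; apply: contraNT ng => /existsPn h; apply/goodP => e ie.
      by have := h e; rewrite ie.
    apply/bigcupP; exists e; last by rewrite in_setI ga in_set be.
    rewrite inE ie /=; apply: contraT => /existsPn ni.
    have : inside S e; last by move/(goodP _ _ ga); rewrite be.
    case/andP: ie => ie /forallP eS; rewrite /inside ie; apply/forallP => l.
    by have := eS l; rewrite !inE (negPf (ni l)).
  apply: leq_trans (subset_leq_card sub) _; apply: leq_trans (leq_card_setU _ _) _.
  rewrite leq_add2l; elim/big_rec2: _ => [|e y X _ le]; first by rewrite cards0.
  by apply: leq_trans (leq_card_setU _ _) _; rewrite leq_add2l.
(* Dropping the indices of [e] from [S] makes goodness independent of [bad e]; as [i] is an index of
   [e] outside [S], at most [d] are dropped. *)
have each e : e \in E -> #|good S :&: [set a | bad e a]| * Q <= 2 ^ d * #|good S|.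
  rewrite inE => /andP[/andP[/injectiveP ie /forallP eS] /existsP[l0 /eqP el0]].
  pose U := [set e l | l : 'I_d.+1].
  have Ud : #|S :\: (S :\: U)| <= d.
    have UE : #|U| = d.+1 by rewrite card_imset // card_ord.
    have : S :\: (S :\: U) \subset U :\ i.
      apply/subsetP => j; rewrite !inE negb_and negbK => /andP[/orP[jU|/negP//] jS].
      by rewrite jU andbT; apply: contraNneq iS => <-.
    move/subset_leq_card => le; apply: leq_trans le _.
    have : i \in U by apply/imsetP; exists l0.
    by move=> iU; have := cardsD1 i U; rewrite iU UE add1n => -[<-].
  have sub : good S :&: [set a | bad e a] \subset good (S :\: U) :&: [set a | bad e a].
    by apply: setSI; apply: goodS; apply: subsetDl.
  have ind : #|good (S :\: U) :&: [set a | bad e a]| * T ^ m = #|good (S :\: U)| * #|[set a | bad e a]|.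
    apply: (card_indep (U := U)) => a b ab.
      apply/goodP/goodP => h f; have := h f; move=> hf jf; have := hf jf.
        rewrite (@bad_dep f a b) // => l; apply: ab.
        by case/andP: jf => _ /forallP/(_ l); rewrite !inE => /andP[].
      rewrite (@bad_dep f a b) // => l; apply: ab.
      by case/andP: jf => _ /forallP/(_ l); rewrite !inE => /andP[].
    by rewrite !inE; apply: bad_dep => l; apply: ab; apply/imsetP; exists l.
  have Tm : 0 < T ^ m by rewrite expn_gt0 T0.
  have := bad_small ie; have := subset_leq_card sub; have := IHs (S :\: U) (subsetDl _ _).
  have := leq_pexp2l (isT : 0 < 2) Ud; move: ind.
  set x := #|good S :&: _|; set y := #|_ :&: _|; set z := #|good (S :\: U)|; set w := #|good S|.
  set t := T ^ m in Tm *; set u := #|_|; set p := 2 ^ _; set p' := 2 ^ d => h1 h2 h3 h4 h5.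
  have h6 : y * Q <= z.
    rewrite -(leq_pmul2r Tm) mulnAC h1 -mulnA leq_mul2l h5 orbT //.
  apply: leq_trans (leq_mul h4 (leqnn Q)) _; apply: leq_trans h6 _; apply: leq_trans h3 _.
  by rewrite leq_mul2r h2 orbT.
have cE : #|E| <= d.+1 * m ^ d.
  apply: leq_trans (card_through i); apply: subset_leq_card.
  by apply/subsetP => e; rewrite !inE => /andP[].
have sumE : (\sum_(e in E) #|good S :&: [set a | bad e a]|) * Q <= (d.+1 * m ^ d) * (2 ^ d * #|good S|).
  rewrite big_distrl /=; apply: (@leq_trans (\sum_(e in E) (2 ^ d * #|good S|))).
    exact: leq_sum.
  by rewrite sum_nat_const leq_mul2r cE orbT.
have half : 2 * (\sum_(e in E) #|good S :&: [set a | bad e a]|) <= #|good S|.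
  have [Q0|Q0] := posnP Q.
    have m0 : 0 < m by apply: leq_ltn_trans (ltn_ord i).
    have : 0 < 2 ^ d.+1 * (d.+1 * m ^ d) by rewrite !muln_gt0 !expn_gt0 m0.
    by move/leq_trans/(_ bad_few); rewrite Q0.
  rewrite -(leq_pmul2r Q0) -mulnA; apply: leq_trans (leq_mul (leqnn 2) sumE) _.
  rewrite mulnC [X in _ <= X]mulnC; apply: leq_trans (leq_mul bad_few (leqnn _)).
  by rewrite expnS; nia.
lia.
Qed.

Lemma exists_good_assignment : exists a, forall e : {ffun 'I_d.+1 -> 'I_m}, injective e -> ~~ bad e a.
Proof.
have pos S : 0 < #|good S|.
  have [n] := ubnP #|S|; elim: n S => // n IH S Sn.
  have [->|[i iS]] := set_0Vmem S.
    apply/card_gt0P; exists [ffun=> Ordinal T0]; apply/goodP => e /andP[_ /forallP/(_ ord0)].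
    by rewrite inE.
  have := @good_half (S :\ i) i; rewrite setD1K // !inE eqxx => /(_ isT).
  have := IH (S :\ i); have := cardsD1 i S; rewrite iS; lia.
have /card_gt0P[a /goodP ga] := pos setT.
exists a => e ie; apply: ga; apply/andP; split; first exact/injectiveP.
by apply/forallP => l; rewrite inE.
Qed.

End Counting.

(** * Random simplices crossed rarely by every hyperplane *)

Section Perturbation.
Variables (R : realFieldType) (d : nat).

(** The moment curve, whose points are in general position by the Vandermonde determinant. *)
Definition mcurve (s : R) : 'rV[R]_d.+1 := \row_(k < d.+1) s ^+ k.

Lemma detrows_mcurve (s : 'I_d.+1 -> R) : injective s -> detrows (fun i => mcurve (s i)) != 0.
Proof.
move=> s_inj; have -> : detrows (fun i => mcurve (s i)) = \det (Vandermonde d.+1 (\row_i s i)).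
  by rewrite -det_tr; congr (\det _); apply/matrixP => i j; rewrite !mxE.
rewrite det_Vandermonde; apply/prodf_neq0 => i _; apply/prodf_neq0 => j ij.
by rewrite !mxE subr_eq0; apply: contraTneq ij => /s_inj->; rewrite ltnn.
Qed.

(** Each determinant is a polynomial in [t], nonzero because its value at [0] is the determinant of
    the [v]. For large [t] the vectors are, up to scale, small perturbations of [g]. *)
Lemma exists_general_perturbation (I : finType) (g v : I -> 'rV[R]_d.+1) (t0 : R) :
  (forall f : 'I_d.+1 -> I, injective f -> detrows (fun i => v (f i)) != 0) ->
  exists2 t, t0 < t & forall f : 'I_d.+1 -> I, injective f ->
    detrows (fun i => t *: g (f i) + v (f i)) != 0.
Proof.
move=> vP; pose A (f : 'I_d.+1 -> I) : 'M[{poly R}]_d.+1 :=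
  \matrix_(i, j) ((g (f i) 0 j)%:P * 'X + (v (f i) 0 j)%:P).
have AE f t : (\det (A f)).[t] = detrows (fun i => t *: g (f i) + v (f i)).
  rewrite -horner_evalE -det_map_mx; congr (\det _); apply/matrixP => i j.
  by rewrite !mxE /= /horner_eval !hornerE mulrC.
have [|t tt0 /allP nr] := @exists_nonroot R
    [seq \det (A f) | f : {ffun 'I_d.+1 -> I} <- enum {: {ffun 'I_d.+1 -> I}} & injectiveb f] t0.
  apply/allP => p /mapP[f]; rewrite mem_filter => /andP[/injectiveP fi _] ->.
  apply: contraNneq (vP f fi) => p0; apply/eqP.
  have := AE f 0; rewrite p0 horner0 => ->; apply: eq_detrows => i.
  by rewrite scale0r add0r.
exists t => // f fi; have := nr (\det (A [ffun i => f i])); rewrite AE.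
have E : injective [ffun i => f i] by move=> i j; rewrite !ffunE => /fi.
move=> h; have : detrows (fun i => t *: g ([ffun i => f i] i) + v ([ffun i => f i] i)) != 0.
  apply: h; apply/mapP; exists [ffun i => f i] => //.
  by rewrite mem_filter mem_enum andbT; apply/injectiveP.
by congr (_ != 0); apply: eq_detrows => i; rewrite ffunE.
Qed.

Lemma general_position_card (I : finType) (q : I -> 'rV[R]_d.+1) :
  (forall f : 'I_d.+1 -> I, injective f -> detrows (fun i => q (f i)) != 0) ->
  forall x, x != 0 -> (#|[set h | dot (q h) x == 0%R]| <= d)%N.
Proof.
move=> qP x x0; rewrite leqNgt; apply/negP => lt.
pose f (i : 'I_d.+1) := enum_val (widen_ord lt i).
have f_inj : injective f by move=> i j /enum_val_inj/(congr1 val)/= ij; apply: val_inj.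
case/negP: (qP f f_inj); apply/detrows_eq0P; exists x => // i.
by have := enum_valP (widen_ord lt i); rewrite inE => /eqP.
Qed.

End Perturbation.

Section Sampler.
Variables (R : realFieldType) (d : nat).
Implicit Types (f : 'rV[R]_d.+1) (vs : seq 'rV[R]_d.+1).

Lemma crossesN f vs : crosses (- f) vs = crosses f vs.
Proof.
rewrite /crosses andbC; congr (_ && _); apply: eq_has => v; rewrite dotNl ?oppr_lt0 ?oppr_gt0 //.
Qed.

Lemma not_crosses_ge0 f vs x : ~~ crosses f vs ->
  (forall w, all (fun v => 0 <= dot v w) vs -> 0 <= dot x w) -> 0 < dot f x ->
  {in vs, forall v, 0 <= dot f v}.
Proof.
move=> nc fx fpos v vvs; rewrite leNgt; apply/negP => vneg.
have /allPn[u uvs] : ~~ all (fun u => 0 <= dot u (- f)) vs.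
  by apply/negP => /fx; rewrite dotNr dotC oppr_ge0 leNgt fpos.
rewrite dotNr oppr_ge0 -ltNge dotC => upos.
by case/negP: nc; apply/andP; split; apply/hasP; [exists u | exists v].
Qed.

(** In the dual arrangement of the points, [f] is a conic combination of at most [d+1] vertices [zs]
    of its face, which are hyperplanes through [d] points. If no test hyperplane around any of them
    crosses a simplex, neither does [f]; this yields the factor [d.+1 ^ 2]. *)
Lemma exists_sampler (I : finType) (x : I -> 'rV[R]_d.+1) (r K : nat) :
  (forall y, y != 0 -> (#|[set i | dot (x i) y == 0%R]| <= d)%N) -> (forall i, x i 0 0 = 1) ->
  (2 * ncodes d r * (d.+1 * d).+1 <= #|I|)%N -> (0 < K)%N -> (2 * d.+1 ^ 2 * (2 * K) <= r.+1)%N ->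
  exists L0, forall L, (L0 <= L)%N -> exists vsY : 'I_(K * L) -> seq 'rV[R]_d.+1 * {set I},
    (forall k, [/\ (0 < size (vsY k).1 <= d.+1)%N, (#|I| <= 2 * ncodes d r * #|(vsY k).2|)%N
      & forall i, i \in (vsY k).2 ->
          forall w, all (fun v => 0 <= dot v w) (vsY k).1 -> 0 <= dot (x i) w]) /\
    forall f, (#|[set k | crosses f (vsY k).1]| <= d.+1 ^ 2 * (2 * L))%N.
Proof.
move=> gpx x0 In K0 rK.
have nc0 : (0 < ncodes d r)%N by rewrite /ncodes !muln_gt0 !expn_gt0 addn_gt0 !orbT.
have dI : (d < #|[set: I]|)%N by rewrite cardsT; apply: leq_trans In; nia.
have exg (a : {set I}) : exists g : 'rV[R]_d.+1,
    #|a| = d -> g != 0 /\ {in a, forall i, dot (x i) g = 0}.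
  have [ad|ad] := eqVneq #|a| d; last by exists 0 => e; rewrite e eqxx in ad.
  have [|g g0 gP] := @exists_orthogonal_seq _ _ [seq x i | i <- enum a].
    by rewrite size_map -cardE ad.
  by exists g => _; split=> // i ia; apply: gP; rewrite map_f // mem_enum.
have [ga gaP] := choice exg.
(* The test hyperplanes are perturbations of the hyperplanes spanned by [d] of the points, [d.+1] around each of
   them, and [d.+1] further ones that bound a simplex containing all points. *)
pose H : finType := ({set I} * 'I_d.+1 + 'I_d.+1)%type.
pose gam (h : H) := mcurve d (nat_of_ord (enum_rank h))%:R : 'rV[R]_d.+1.
have gamP (f : 'I_d.+1 -> H) : injective f -> detrows (fun i => gam (f i)) != 0.
  move=> fi; apply: (detrows_mcurve (s := fun i => (nat_of_ord (enum_rank (f i)))%:R)).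
  by move=> i j /eqP; rewrite eqr_nat => /eqP/val_inj/enum_rank_inj/fi.
have exb (a : {set I}) : exists be : 'I_d.+1 -> R, ga a = \sum_b be b *: gam (inl (a, b)).
  pose M := \matrix_b gam (inl (a, b)).
  have Mu : M \in unitmx by rewrite unitmxE unitfE; apply: gamP => b b' [].
  exists (fun b => (ga a *m invmx M) 0 b).
  rewrite -{1}(mulmxKV Mu (ga a)) mulmx_sum_row; apply: eq_bigr => b _.
  by rewrite rowK.
have [be beP] := choice exb.
(* Signs are flipped so that [ga a] becomes a nonnegative combination of its perturbing vectors. *)
pose v (h : H) := match h with
  | inl (a, b) => (if be a b < 0 then -1 else 1) *: gam h | inr _ => gam h end.
(* [delta_mx 0 0] is the hyperplane at infinity; it has value [1] at all points, so its
   perturbations bound a simplex around them. *)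
pose gg (h : H) := match h with inl (a, _) => ga a | inr _ => delta_mx 0 0 end.
have gaE a : ga a = \sum_b `|be a b| *: v (inl (a, b)).
  rewrite {1}beP; apply: eq_bigr => b _; rewrite /v scalerA; congr (_ *: _).
  have [lt|ge] := ltP (be a b) 0; last by rewrite ger0_norm // mulr1.
  by rewrite ltr0_norm // mulrN1 opprK.
have vP (f : 'I_d.+1 -> H) : injective f -> detrows (fun i => v (f i)) != 0.
  move=> /gamP; apply: contraNneq => /eqP/detrows_eq0P[y y0 yP]; apply/detrows_eq0P; exists y => // i.
  have := yP i; rewrite /v; case: (f i) => [[a b]|j] //=; rewrite dotZl.
  by case: ifP => _; rewrite ?mul1r // mulN1r => /eqP; rewrite oppr_eq0 => /eqP.
(* Beyond [t0] the perturbed hyperplane [q h] has the sign of [gg h] at every point not on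
   [gg h]. *)
pose t0 := \sum_h \sum_i `|dot (v h) (x i)| / `|dot (gg h) (x i)|.
have [t tt0 qP] := exists_general_perturbation gg t0 vP.
pose q h := t *: gg h + v h.
have gpq := general_position_card (q := q) qP.
have qsg h i : `|dot (v h) (x i)| < t * `|dot (gg h) (x i)| \/ dot (gg h) (x i) = 0.
  have [|n0] := eqVneq (dot (gg h) (x i)) 0; [by right | left].
  rewrite -ltr_pdivrMr ?normr_gt0 //; apply: le_lt_trans tt0.
  rewrite /t0 (bigD1 h) //= (bigD1 i) //= -addrA lerDl addr_ge0 //.
    by apply: sumr_ge0 => j _; rewrite divr_ge0.
  by apply: sumr_ge0 => k _; apply: sumr_ge0 => j _; rewrite divr_ge0.
have qpos h i : 0 < dot (gg h) (x i) -> 0 < dot (q h) (x i).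
  move=> gt0; have [lt|e] := qsg h i; last by rewrite e ltxx in gt0.
  rewrite dotDl dotZl; move: lt; rewrite (gtr0_norm gt0) ltr_norml => /andP[lt _]; lra.
have qneg h i : dot (gg h) (x i) < 0 -> dot (q h) (x i) < 0.
  move=> lt0; have [lt|e] := qsg h i; last by rewrite e ltxx in lt0.
  rewrite dotDl dotZl; move: lt; rewrite (ltr0_norm lt0) ltr_norml => /andP[_ lt]; lra.
have t_gt0 : 0 < t.
  apply: le_lt_trans tt0; apply: sumr_ge0 => h _; apply: sumr_ge0 => i _; exact: divr_ge0.
(* A positive multiple of [ga a] is a nonnegative combination of the test hyperplanes around it, so
   nonnegativity on a simplex passes from them to [ga a]. *)
have qga a u : (t * (\sum_b `|be a b|) + 1) * dot (ga a) u = \sum_b `|be a b| * dot (q (inl (a, b))) u.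
  rewrite mulrDl mul1r {2}gaE dot_suml -mulrA mulr_suml mulr_sumr -big_split /=.
  by apply: eq_bigr => b _; rewrite dotDl !dotZl /=; ring.
have cpos a : 0 < t * (\sum_b `|be a b|) + 1.
  by rewrite ltr_wpDl // mulr_ge0 ?(ltW t_gt0) // sumr_ge0.
have Zpos z vs i : z != 0 -> #|zset x setT z| = d -> 0 < dot z (x i) ->
    (forall b, ~~ crosses (q (inl (zset x setT z, b))) vs) ->
    (forall w, all (fun v => 0 <= dot v w) vs -> 0 <= dot (x i) w) ->
    {in vs, forall u, 0 <= dot z u}.
  move=> z0 zd zi nc fx u uvs; set a := zset x setT z in zd nc *.
  have [g0 gz] := gaP a zd.
  have [|c c0 zE] := vertex_unique gpx dI zd g0 z0 _ (subxx _).
    by apply/subsetP => j ja; rewrite !inE gz ?eqxx.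
  rewrite zE dotZl; rewrite zE dotZl in zi.
  have [c_gt|c_lt|ce] := ltrgt0P c; last by rewrite ce eqxx in c0.
  - rewrite pmulr_rge0 // -(pmulr_rge0 _ (cpos a)) qga; apply: sumr_ge0 => b _.
    rewrite mulr_ge0 //; apply: not_crosses_ge0 (nc b) fx _ _ uvs.
    by apply: qpos; move: zi; rewrite pmulr_rgt0.
  - rewrite nmulr_rge0 // -(pmulr_rle0 _ (cpos a)) qga; apply: sumr_le0 => b _.
    rewrite mulr_ge0_le0 // -oppr_ge0 -dotNl.
    apply: (not_crosses_ge0 (vs := vs) _ fx _ uvs); first by rewrite crossesN.
    by rewrite dotNl oppr_gt0; apply: qneg; move: zi; rewrite nmulr_rgt0.
have xq i j : 0 < dot (q (inr j)) (x i).
  by apply: qpos; rewrite /= dot_delta x0.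
pose good (p : seq 'rV[R]_d.+1 * {set I}) :=
  [/\ (0 < size p.1 <= d.+1)%N, (#|I| <= 2 * ncodes d r * #|p.2|)%N
    & forall i, i \in p.2 -> forall w, all (fun v => 0 <= dot v w) p.1 -> 0 <= dot (x i) w].
have I0 : (0 < #|I|)%N by rewrite -cardsT; apply: leq_ltn_trans dI.
have oracle (Om : finType) (p : Om -> H) : (0 < #|Om|)%N ->
    exists v, good v /\ (#|[set o | crosses (q (p o)) v.1]| * (2 * K) <= #|Om|)%N.
  move=> Om0; have inr_inj : injective (@inr ({set I} * 'I_d.+1) 'I_d.+1) by move=> j j' [].
  have [vs [Y [sz nY fY cY]]] := exists_cutting gpq inr_inj p r xq Om0 I0.
  exists (vs, Y); split=> //=; rewrite -(@leq_pmul2l (2 * d.+1 ^ 2)) ?muln_gt0 ?expn_gt0 //.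
  by apply: leq_trans cY; rewrite mulnCA leq_mul2l rK orbT.
have H0 : (0 < #|{: H}|)%N by apply/card_gt0P; exists (inr ord0).
exists #|{: H}| => L leL.
have HL : (#|{: H}| <= 2 ^ L)%N by apply: leq_trans leL (ltnW (ltn_expl _ _)).
have [vsY [gvs cvs]] := exists_low_crossing (cross := fun p h => crosses (q h) p.1) K0 oracle H0 HL.
exists vsY; split=> // f.
have [->|f0] := eqVneq f 0.
  rewrite (eq_card0 (A := [set k | _])) // => k; rewrite inE; apply/negP => /andP[/hasP[u _]].
  by rewrite dot0l ltxx.
have [zs [szs vzs czs fzs]] := cell_decomposition gpx dI f0.
pose F (zb : 'rV[R]_d.+1 * 'I_d.+1) :=
  [set k | crosses (q (inl (zset x setT zb.1, zb.2))) (vsY k).1].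
pose s := [seq (z, b) | z <- zs, b <- enum 'I_d.+1].
apply: (@leq_trans #|[set k | has (fun zb => k \in F zb) s]|); last first.
  apply: leq_trans (card_has_leq (c := 2 * L) _) _; first by move=> zb _; apply: cvs.
  rewrite size_allpairs -cardE card_ord leq_mul2r -mulnn leq_mul2r /=.
  by rewrite (leq_trans _ szs) ?leq_addr // orbT.
apply: subset_leq_card; apply/subsetP => k; rewrite !inE; apply: contraLR => /hasPn nc.
have {}nc z b : z \in zs -> ~~ crosses (q (inl (zset x setT z, b))) (vsY k).1.
  move=> zzs; have := nc (z, b); rewrite inE; apply.
  by apply/allpairsP; exists (z, b); rewrite mem_enum.
have [_ nY fY] := gvs k.
(* [Y] has more than [(d+1) d] points, and each of the at most [d+1] hyperplanes [zs] contains only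
   [d] points. *)
have [i iY iz] : exists2 i, i \in (vsY k).2 & {in zs, forall z, dot z (x i) != 0}.
  pose U := [set i | has (fun z => i \in zset x setT z) zs].
  have : ~~ ((vsY k).2 \subset U).
    apply/negP => /subset_leq_card le.
    have cU : (#|U| <= d.+1 * d)%N.
      apply: leq_trans (card_has_leq (c := d) _) _.
        by move=> z /(allP vzs)/andP[_ /eqP->].
      by rewrite leq_mul2r (leq_trans _ szs) ?leq_addr // orbT.
    have := leq_trans In nY; rewrite leq_pmul2l ?muln_gt0 //; lia.
  case/subsetPn => i iY; rewrite inE => /hasPn iU; exists i => // z zzs.
  by have := iU z zzs; rewrite !inE dotC.
have sgz z : z \in zs -> compat (dot f (x i)) (dot z (x i)).
  by move=> zzs; have /cellP/(_ i) := allP czs z zzs; rewrite inE !(dotC (x i)); apply.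
have zP z : z \in zs -> z != 0 /\ #|zset x setT z| = d.
  by move=> /(allP vzs)/andP[z0 /eqP zd].
have [fi|fi] := leP 0 (dot f (x i)).
  apply/negP => /andP[_ /hasP[u uvs]]; rewrite ltNge => /negP; apply; apply: fzs.
  apply/allP => z zzs; have [z0 zd] := zP z zzs.
  apply: (Zpos z (vsY k).1 i) => // [|b|]; last exact: fY; last exact: nc.
  by rewrite lt_def iz //=; apply: compat_ge0 (sgz z zzs) fi.
apply/negP => /andP[/hasP[u uvs]]; rewrite ltNge -oppr_ge0 -dotNr => /negP + _; apply; apply: fzs.
apply/allP => z zzs; have [z0 zd] := zP z zzs.
have zN : zset x setT (- z) = zset x setT z by rewrite -scaleN1r zsetZ // oppr_eq0 oner_eq0.
rewrite dotNr -dotNl; apply: (Zpos (- z) (vsY k).1 i); rewrite ?oppr_eq0 ?zN //.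
- by rewrite dotNl oppr_gt0 lt_neqAle iz //=; apply: compat_le0 (sgz z zzs) (ltW fi).
- by move=> b; apply: nc.
- exact: fY.
Qed.

End Sampler.

(** * Selecting one simplex per set *)

Section Selection.
Variables (R : realFieldType) (d m T : nat).
Let vec := 'rV[R]_d.+1.

Lemma eq_cofrow (p p' : 'I_d.+1 -> vec) l : (forall i, i != l -> p i = p' i) -> cofrow p l = cofrow p' l.
Proof.
move=> e; rewrite -(cofrow_upd p l (p' l)); congr cofrow; apply/funext => i.
by rewrite /upd; case: eqP => [->//|/eqP/e].
Qed.

Section Generic.
Variable v : 'I_m -> 'I_T -> 'I_d.+1 -> vec.

Definition corner (u : 'I_m -> 'I_T -> vec) i k (o : option 'I_d.+1) :=
  if o is Some j then v i k j else u i k.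

Definition corners u (e : 'I_d.+1 -> 'I_m) (a : 'I_m -> 'I_T) p : 'I_d.+1 -> vec :=
  fun l => corner u (e l) (a (e l)) (p l).

Lemma corners_upd u e a p l o :
  corners u e a (upd p l o) = upd (corners u e a p) l (corner u (e l) (a (e l)) o).
Proof. by apply/funext => i; rewrite /corners /upd; case: eqP => [->|]. Qed.

Definition in_cone (x : vec) i k := forall w, (forall j, 0 <= dot (v i k j) w) -> 0 <= dot x w.

(* [u i k] is a point of the simplex [v i k] on which a mixed determinant vanishes only if it vanishes at all
   vertices; comparing with it rules out sign changes that pass through degenerate vertex tuples. *)
Lemma exists_generic_corners : exists u, (forall i k, in_cone (u i k) i k) /\
  forall e a p l, injective e -> p l = None -> detrows (corners u e a p) = 0 ->
    forall j, detrows (corners u e a (upd p l (Some j))) = 0.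
Proof.
(* The points [u i] are made generic for one index [i] after another; at stage [n] only patterns
   using generic points of indices below [n] are controlled. *)
suff G n : exists u, (forall i k, in_cone (u i k) i k) /\
    forall (e : 'I_d.+1 -> 'I_m) a p l, injective e -> (forall l', p l' = None -> (e l' < n)%N) -> p l = None ->
      detrows (corners u e a p) = 0 -> forall j, detrows (corners u e a (upd p l (Some j))) = 0.
  by have [u [uc uP]] := G m; exists u; split=> // e a p l ei; apply: uP.
elim: n => [|n [u [uc uP]]].
  by exists (fun i k => v i k ord0); split=> [i k w|e a p l _ /(_ l) h /h].
have [le_mn|lt_nm] := leqP m n.
  by exists u; split=> // e a p l ei _; apply: uP => // l' _; apply: leq_trans le_mn.
pose i0 := Ordinal lt_nm.
pose F := [seq cofrow (corners u x.1.1.1 x.1.1.2 x.1.2) x.2 | x :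
  {ffun 'I_d.+1 -> 'I_m} * {ffun 'I_m -> 'I_T} * {ffun 'I_d.+1 -> option 'I_d.+1} * 'I_d.+1].
have exc t : exists c : 'I_d.+1 -> R, (forall j, 0 <= c j) /\
    {in F, forall h, dot h (\sum_j c j *: v i0 t j) = 0 -> forall j, dot h (v i0 t j) = 0}.
  by have [c c0 cP] := exists_generic_point F (v i0 t); exists c.
have [c cP] := choice exc.
pose u' i t := if i == i0 then \sum_j c t j *: v i0 t j else u i t.
have sameu e a p : (forall l, p l = None -> e l != i0) -> corners u' e a p = corners u e a p.
  move=> h; apply/funext => l; rewrite /corners /corner; case E: (p l) => //.
  by rewrite /u' (negPf (h l E)).
exists u'; split=> [i t w|e a p l ei plt pl].
  rewrite /u'; case: eqP => [->|_]; last exact: uc.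
  move=> wv; rewrite dot_suml; apply: sumr_ge0 => j _; rewrite dotZl mulr_ge0 //.
  by have [] := cP t.
have lt_n l' : (e l' < n.+1)%N -> e l' != i0 -> (e l' < n)%N.
  by rewrite ltnS leq_eqVlt => /orP[/eqP h|//]; rewrite -(inj_eq val_inj) /= h eqxx.
have [[l' pl' el']|no] := pselect (exists2 l', p l' = None & e l' = i0); last first.
  have ne l' : p l' = None -> e l' != i0 by move=> pl'; apply/eqP => el'; apply: no; exists l'.
  rewrite sameu // => d0 j; rewrite sameu.
    by apply: uP => // l' pl'; apply: lt_n; [apply: plt | apply: ne].
  by move=> l'; rewrite /upd; case: eqP => // _; apply: ne.
have ne l1 : l1 != l' -> e l1 != i0.
  by apply: contraNneq => h; apply/eqP/ei; rewrite h.
have lin p1 : p1 l' = None -> detrows (corners u' e a p1) =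
    \sum_j c (a i0) j * detrows (corners u' e a (upd p1 l' (Some j))).
  move=> p1l; rewrite (detrows_cofrow _ l') {1}/corners p1l /corner el' /u' eqxx -/u'.
  rewrite dot_suml; apply: eq_bigr => j _; rewrite dotZl corners_upd detrows_upd.
  by rewrite /corner el'.
have zero p1 : p1 l' = None -> detrows (corners u' e a p1) = 0 ->
    forall j, detrows (corners u' e a (upd p1 l' (Some j))) = 0.
  move=> p1l d0 j; rewrite corners_upd detrows_upd /corner el' dotC.
  have [_ gen] := cP (a i0); apply: gen.
    apply/mapP; exists ([ffun l1 => e l1], [ffun i => a i], [ffun l1 => p1 l1], l'); first by rewrite mem_enum.
    apply: eq_cofrow => l1 l1l; rewrite /= /corners /corner !ffunE; case: (p1 l1) => //.
    by rewrite /u' (negPf (ne _ l1l)).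
  move: d0; rewrite (detrows_cofrow _ l') {1}/corners p1l /corner el' /u' eqxx -/u' => d0.
  by rewrite dotC.
move=> d0 j; have z1 := zero p pl' d0.
have [->|ll'] := eqVneq l l'; first exact: z1.
have updC j' : upd (upd p l (Some j)) l' (Some j') = upd (upd p l' (Some j')) l (Some j).
  by apply/funext => l1; rewrite /upd; case: eqP => // ->; rewrite eq_sym (negPf ll').
(* The generic row at [l'] is expanded over the vertices of its simplex; each term vanishes by
   [zero] and the induction hypothesis. *)
rewrite lin; last by rewrite /upd eq_sym (negPf ll').
apply: big1 => j' _; rewrite updC.
set p1 := upd p l' (Some j').
have p1ne l1 : p1 l1 = None -> e l1 != i0 by rewrite /p1 /upd; case: eqP => // /eqP/ne.
rewrite sameu; last by move=> l1; rewrite {1}/upd; case: eqP => // _; apply: p1ne.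
rewrite (uP e a p1 l) ?mulr0 //.
- move=> l1 p1l; apply: lt_n; last exact: p1ne.
  by apply: plt; move: p1l; rewrite /p1 /upd; case: eqP.
- by rewrite /p1 /upd (negPf ll').
- by rewrite -sameu // z1.
Qed.

End Generic.

(** A bad event is a hyperplane through corners of [d] simplices that crosses the remaining one. A
    tuple [e] has [(d+1) (d+2)^(d+1)] choices of position and pattern; resampling the remaining
    simplex bounds each probability by [1 / Q1]. *)
Lemma exists_sign_selection (vs : 'I_m -> 'I_T -> seq vec) (Q1 : nat) :
  (forall i k, 0 < size (vs i k) <= d.+1)%N ->
  (forall i f, #|[set k | crosses f (vs i k)]| * Q1 <= T)%N -> (0 < T)%N -> (0 < m)%N ->
  (2 ^ d.+1 * (d.+1 * m ^ d) * (d.+1 * d.+2 ^ d.+1) <= Q1)%N ->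
  exists a : {ffun 'I_m -> 'I_T}, forall e : 'I_d.+1 -> 'I_m, injective e ->
    exists s : R, (s = 1 \/ s = -1) /\
      forall p : 'I_d.+1 -> vec, (forall l, p l \in vs (e l) (a (e l))) -> 0 <= s * detrows p.
Proof.
move=> szv crv T0 m0 Q1P.
(* Simplices with fewer than [d+1] vertices are padded by their first vertex. *)
pose v i k (j : 'I_d.+1) := nth (nth 0 (vs i k) 0) (vs i k) j.
have v_in i k j : v i k j \in vs i k.
  rewrite /v; have [lt|ge] := ltnP j (size (vs i k)); first exact: mem_nth.
  by rewrite nth_default // mem_nth //; case/andP: (szv i k).
have in_v i k x : x \in vs i k -> exists j, x = v i k j.
  move=> xv; have lt : (index x (vs i k) < d.+1)%N.
    by apply: leq_trans (proj2 (andP (szv i k))); rewrite index_mem.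
  by exists (Ordinal lt); rewrite /v /= nth_index.
have [u [uc uP]] := exists_generic_corners v.
pose B e (a : {ffun 'I_m -> 'I_T}) (lp : 'I_d.+1 * {ffun 'I_d.+1 -> option 'I_d.+1}) :=
  crosses (cofrow (corners v u e a lp.2) lp.1) (vs (e lp.1) (a (e lp.1))).
pose bad (e : {ffun 'I_d.+1 -> 'I_m}) a := has (B e a) (enum {: 'I_d.+1 * {ffun 'I_d.+1 -> option 'I_d.+1}}).
have bad_dep (e : {ffun 'I_d.+1 -> 'I_m}) (a b : {ffun 'I_m -> 'I_T}) :
    (forall l, a (e l) = b (e l)) -> bad e a = bad e b.
  move=> ab; apply: eq_has => lp; rewrite /B ab; congr (crosses (cofrow _ _) _).
  by apply/funext => l; rewrite /corners ab.
have Q10 : (0 < Q1)%N by apply: leq_trans Q1P; rewrite !muln_gt0 !expn_gt0 m0.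
have bad_small (e : {ffun 'I_d.+1 -> 'I_m}) : injective e ->
    (#|[set a | bad e a]| * (2 ^ d.+1 * (d.+1 * m ^ d)) <= T ^ m)%N.
  move=> ei; have each lp : (#|[set a | B e a lp]| <= T ^ m %/ Q1)%N.
    rewrite leq_divRL //; apply: (card_avg (i := e lp.1)) => a.
    set w := cofrow (corners v u e a lp.2) lp.1.
    apply: leq_trans (crv (e lp.1) w); rewrite leq_mul2r; apply/orP; right.
    apply: subset_leq_card; apply/subsetP => t; rewrite !inE /B ffunE eqxx.
    congr (crosses _ _ : Prop); apply: eq_cofrow => l ll.
    by rewrite /corners ffunE (inj_eq ei) (negPf ll).
  have := card_has_leq (F := fun lp => [set a | B e a lp]) (c := T ^ m %/ Q1)
    (s := enum {: 'I_d.+1 * {ffun 'I_d.+1 -> option 'I_d.+1}}) (fun lp _ => each lp).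
  rewrite -cardE card_prod card_ffun card_option !card_ord => le.
  have E : [set t | has (fun z => t \in [set a | B e a z]) (enum {: 'I_d.+1 * {ffun 'I_d.+1 -> option 'I_d.+1}})]
           = [set a | bad e a].
    by apply/setP => a; rewrite !inE; apply: eq_has => lp; rewrite inE.
  rewrite E in le; apply: leq_trans (leq_mul le (leqnn _)) _.
  apply: leq_trans (leq_trunc_div (T ^ m) Q1).
  by rewrite mulnAC [X in (_ <= X)%N]mulnC leq_mul2r mulnC Q1P orbT.
have [a aP] := exists_good_assignment bad_dep bad_small (leqnn _) T0.
exists a => e ei; have {aP} nb lp : ~~ B [ffun l => e l] a lp.
  have := aP [ffun l => e l]; move/(_ _)/hasPn; apply; last by rewrite mem_enum.
  by move=> l l'; rewrite !ffunE => /ei.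
have {}nb l p : ~~ crosses (cofrow (corners v u e a p) l) (vs (e l) (a (e l))).
  have := nb (l, [ffun l => p l]); rewrite /B /= ffunE; congr (~~ crosses (cofrow _ _) _ : Prop).
  by apply/funext => l'; rewrite /corners !ffunE.
pose s : R := if 0 <= detrows (corners v u e a (fun=> None)) then 1 else -1.
have s1 : s = 1 \/ s = -1 by rewrite /s; case: ifP; [left | right].
exists s; split=> //.
(* Induction on the number of vertices in the pattern: replacing a generic point by a vertex cannot
   flip the sign, since the hyperplane through the other corners does not cross the simplex, and a
   zero determinant stays zero by the choice of [u]. *)
have key n p : (#|[set l | p l != None :> option 'I_d.+1]| < n)%N -> 0 <= s * detrows (corners v u e a p).
  elim: n p => // n IH p lt.
  have [e0|[l]] := set_0Vmem [set l | p l != None :> option 'I_d.+1].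
    have -> : p = fun=> None.
      by apply/funext => l; apply/eqP; move/setP/(_ l): e0; rewrite !inE => /negbFE.
    by rewrite /s; case: ifP => [|/negbT]; rewrite ?mul1r // -ltNge mulN1r oppr_ge0 => /ltW.
  rewrite inE; case pl: (p l) => [j|] // _.
  pose p' := upd p l None.
  have := IH p'; rewrite (leq_trans _ (_ : #|[set l | p l != None :> option 'I_d.+1]| <= n)%N) //; last first.
    apply: proper_card; apply/properP; split.
      by apply/subsetP => l'; rewrite !inE /p' /upd; case: (l' == l).
    by exists l; rewrite !inE /p' /upd ?eqxx // pl.
  move=> /(_ isT).
  have pE : p = upd p' l (Some j).
    by apply/funext => l'; rewrite /p' /upd; case: eqP => // ->.
  have [d0 _|dn0 ge0] := eqVneq (detrows (corners v u e a p')) 0.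
    by rewrite pE (uP e a p' l) ?mulr0 // /p' /upd eqxx.
  set w := cofrow (corners v u e a p') l.
  have dE : detrows (corners v u e a p') = dot (u (e l) (a (e l))) w.
    by rewrite (detrows_cofrow _ l) {1}/corners /p' {1}/upd eqxx.
  have -> : detrows (corners v u e a p) = dot (v (e l) (a (e l)) j) w.
    by rewrite pE corners_upd detrows_upd.
  have ncs : ~~ crosses (s *: w) (vs (e l) (a (e l))).
    by case: s1 => ->; rewrite ?scale1r ?scaleN1r ?crossesN; apply: nb.
  rewrite -dotZr dotC; apply: (not_crosses_ge0 ncs (x := u (e l) (a (e l)))) => //.
    by move=> w' /allP h; apply: uc => j'; apply: h.
  rewrite dotC dotZr -dE lt_def ge0 andbT mulf_neq0 //.
  by case: s1 => ->; rewrite ?oppr_eq0 oner_eq0.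
move=> p pv; have exj l : exists j, p l = v (e l) (a (e l)) j by apply: in_v.
have [j jP] := choice exj.
have -> : p = corners v u e a (fun l => Some (j l)) by apply/funext => l; rewrite jP.
exact: key (ltnSn _).
Qed.

End Selection.

(** * The lower bound *)

Section Families.
Variables (R : realType) (d : nat).

Definition hom (p : pt R d) : 'rV[R]_d.+1 := row_mx (const_mx 1 : 'rV[R]_1) p.

Lemma hom0 p : hom p 0 0 = 1.
Proof.
transitivity (row_mx (const_mx 1 : 'rV[R]_1) p 0 (lshift d 0)); last by rewrite row_mxEl mxE.
by congr (fun_of_matrix _ _ _); apply: val_inj.
Qed.

Lemma hom_lift p (j : 'I_d) : hom p 0 (lift 0 j) = p 0 j.
Proof.
transitivity (row_mx (const_mx 1 : 'rV[R]_1) p 0 (rshift 1 j)); last by rewrite row_mxEr.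
by congr (fun_of_matrix _ _ _); apply: val_inj.
Qed.

Lemma orientationE (y : 'I_d.+1 -> pt R d) : orientation y = Num.sg (detrows (fun i => hom (y i))).
Proof. by []. Qed.

Lemma gen_pos_detrows (S : {fset pt R d}) (y : 'I_d.+1 -> pt R d) :
  gen_pos S -> injective y -> (forall i, y i \in S) -> detrows (fun i => hom (y i)) != 0.
Proof.
move=> gS yi yS; have /eqP := gS _ y (leqnn _) yi yS.
rewrite -[_ == _]/(row_free (affmx y : 'M[R]_d.+1)) row_free_unit unitmxE unitfE.
by [].
Qed.

Lemma sub_bigfsetU m (X : 'I_m -> {fset pt R d}) i x :
  x \in X i -> x \in (\big[fsetU/fset0]_(i < m) X i)%fset.
Proof. by move=> xX; apply/bigfcupP; exists i; rewrite ?mem_index_enum. Qed.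

Lemma family_detrows m (X : 'I_m -> {fset pt R d}) (f : 'I_d.+1 -> 'I_m) (y : 'I_d.+1 -> pt R d) :
  family_gen_pos X -> injective f -> (forall l, y l \in X (f l)) -> detrows (fun i => hom (y i)) != 0.
Proof.
move=> [dis gS] fi yX; apply: (gen_pos_detrows gS) => [l l' e|l]; last exact: sub_bigfsetU (yX l).
apply/eqP; apply: contraT => ne; have := dis (f l) (f l'); rewrite (inj_eq fi) => /(_ ne).
by move/fdisjointP/(_ _ (yX l)); rewrite e yX.
Qed.

Lemma family_gp m (X : 'I_m -> {fset pt R d}) i : family_gen_pos X ->
  forall y, y != 0 -> (#|[set x : X i | dot (hom (val x)) y == 0%R]| <= d)%N.
Proof.
move=> [_ gS]; apply: general_position_card => f fi.
apply: (gen_pos_detrows gS (y := fun i => val (f i))) => [l l' /val_inj/fi//|l].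
exact: sub_bigfsetU (valP (f l)).
Qed.

Lemma exists_fset_sampler m (X : 'I_m -> {fset pt R d}) i (r K : nat) :
  family_gen_pos X -> X i != fset0 -> (0 < K)%N -> (2 * d.+1 ^ 2 * (2 * K) <= r.+1)%N ->
  exists L0, forall L, (L0 <= L)%N -> exists vsY : 'I_(K * L) -> seq 'rV[R]_d.+1 * {fset pt R d},
    (forall k, [/\ (0 < size (vsY k).1 <= d.+1)%N, ((vsY k).2 `<=` X i)%fset,
        (#|` X i| <= 2 * ncodes d r * (d.+1 * d).+1 * #|` (vsY k).2|)%N
      & forall y, y \in (vsY k).2 ->
          forall w, all (fun v => 0 <= dot v w) (vsY k).1 -> 0 <= dot (hom y) w]) /\
    forall f, (#|[set k | crosses f (vsY k).1]| <= d.+1 ^ 2 * (2 * L))%N.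
Proof.
move=> gX X0 K0 rK; set C := (2 * ncodes d r * (d.+1 * d).+1)%N.
(* In a set with fewer than [C] points a single point, as a degenerate simplex, is a large enough
   fraction. *)
have [le|lt] := leqP C #|` X i|; last first.
  have [x xX] := fset0Pn _ X0.
  exists 0%N => L _; exists (fun=> ([:: hom x], [fset x]%fset)); split=> [k|f] /=.
    split=> //; first by rewrite fsub1set.
      by rewrite cardfs1 muln1 ltnW.
    by move=> y /fset1P-> w /andP[].
  rewrite (eq_card0 (A := [set k | _])) // => k; rewrite inE; apply/negP => /andP[/=].
  by rewrite !orbF => gt0; rewrite ltNge ltW.
have [|L0 L0P] := @exists_sampler R d (X i) (fun x => hom (val x)) r K (family_gp i gX)
   (fun x => hom0 (val x)) _ K0 rK; first by rewrite -cardfE.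
exists L0 => L /L0P[vsY [gY cY]].
exists (fun k => ((vsY k).1, [fset val x | x in (vsY k).2]%fset)); split=> [k|f]; last exact: cY.
have [sz nY fY] := gY k; split=> //.
- by apply/fsubsetP => y /imfsetP[x _ ->]; apply: valP.
- have -> : #|` [fset val x | x in (vsY k).2]%fset| = #|(vsY k).2|.
    by rewrite card_imfset //=; [rewrite -cardE | exact: val_inj].
  by rewrite cardfE; apply: leq_trans nY _; rewrite /C leq_mul2r leq_pmulr ?orbT.
- by move=> y /imfsetP[x xY ->]; apply: fY.
Qed.

(** The inverse of the crossing probability that [exists_sign_selection] requires; [nsample] is a
    sample size achieving it, and [loss] is the inverse of the fraction kept. *)
Definition ntuples m := (2 ^ d.+1 * (d.+1 * m ^ d) * (d.+1 * d.+2 ^ d.+1))%N.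
Definition nsample m := (2 * d.+1 ^ 2 * (2 * (d.+1 ^ 2 * 2 * ntuples m)))%N.
Definition loss m := (2 * ncodes d (nsample m) * (d.+1 * d).+1)%N.

Lemma exists_same_type m (X : 'I_m -> {fset pt R d}) : (0 < m)%N ->
  (forall i, X i != fset0) -> family_gen_pos X ->
  exists Y : 'I_m -> {fset pt R d}, [/\ forall i, (Y i `<=` X i)%fset, same_type Y
    & forall i, (#|` X i| <= loss m * #|` Y i|)%N].
Proof.
move=> m0 X0 gX; pose K := (d.+1 ^ 2 * 2 * ntuples m)%N.
have Q0 : (0 < ntuples m)%N by rewrite /ntuples !muln_gt0 !expn_gt0 m0.
have K0 : (0 < K)%N by rewrite /K muln_gt0 Q0 andbT muln_gt0 expn_gt0.
have exs i := exists_fset_sampler gX (X0 i) K0 (leqnSn (nsample m)).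
have [L0 L0P] := choice exs.
(* A common [L] gives every set the same number of simplices. *)
pose L := (\sum_i L0 i).+1; have leL i : (L0 i <= L)%N by rewrite /L (bigD1 i) //= ltnW // ltnS leq_addr.
have [vsY vsYP] := choice (fun i => L0P i L (leL i)).
have [|i f||a aP] := @exists_sign_selection R d m (K * L) (fun i k => (vsY i k).1) (ntuples m) _ _ _ m0 (leqnn _).
- by move=> i k; have [/(_ k)[]] := vsYP i.
- have [_ /(_ f) le] := vsYP i; apply: leq_trans (leq_mul le (leqnn _)) _.
  by rewrite /K; apply: eq_leq; ring.
- by rewrite muln_gt0 K0.
exists (fun i => (vsY i (a i)).2); split=> [i||i]; try by have [/(_ (a i))[]] := vsYP i.
move=> f fi y y' yY yY'; have [s [s1 sP]] := aP f fi.
suff H z : (forall j, z j \in (vsY (f j) (a (f j))).2) -> orientation z = s by rewrite !H.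
move=> zY; have n0 : detrows (fun i => hom (z i)) != 0.
  apply: family_detrows gX fi _ => l; have [/(_ (a (f l)))[_ /fsubsetP sub _ _] _] := vsYP (f l).
  exact: sub.
(* The weak sign passes from vertices to points of the simplices row by row; general position of the
   points then makes it strict. *)
have : 0 <= s * detrows (fun i => hom (z i)).
  apply: (detrows_propagate (P := fun r => 0 <= s * r) (A := fun l x => x \in (vsY (f l) (a (f l))).1)
    (A' := fun l x => exists2 y, y \in (vsY (f l) (a (f l))).2 & x = hom y)) => [l w h x [t tY ->]|//|l].
    have [/(_ (a (f l)))[_ _ _ far] _] := vsYP (f l).
    by rewrite -dotZr; apply: (far t tY); apply/allP => v vv; rewrite dotZr; apply: h.
  by exists (z l).
rewrite orientationE; case: s1 => ->; rewrite ?mul1r ?mulN1r => ge0.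
  by rewrite gtr0_sg // lt_def n0.
by rewrite ltr0_sg // lt_neqAle n0 -oppr_ge0.
Qed.

End Families.

(** Every factor is bounded by powers of [d] and [m], using [2 <= d] and [d+2 <= d^2]. The exponent
    of [d] comes out as [4 d^2 + 21 d + 6], well below [50 d^3]. *)
Lemma loss_leq d m : (2 <= d)%N -> (d <= m)%N -> (loss d m <= d ^ (50 * d ^ 3) * m ^ (d ^ 2))%N.
Proof.
move=> hd hm; have d0 : (0 < d)%N by apply: leq_trans hd.
have m0 : (0 < m)%N by apply: leq_trans hm.
have D2 : (d.+1 <= d ^ 2)%N by rewrite -mulnn; nia.
have D3 : (d.+2 <= d ^ 2)%N by rewrite -mulnn; nia.
have D4 : ((d.+1 * d).+1 <= d ^ 3)%N by rewrite !expnS expn0; nia.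
have expl a b k : (a <= d ^ b)%N -> (a ^ k <= d ^ (b * k))%N.
  move=> le; case: k => [|k]; first by rewrite muln0.
  by rewrite expnM leq_exp2r.
have e2 k : (2 ^ k <= d ^ k)%N by have := @expl 2 1 k; rewrite mul1n expn1; apply.
have nt : (ntuples d m <= d ^ (3 * d + 7) * m ^ d)%N.
  have -> : (d ^ (3 * d + 7) * m ^ d = d ^ d.+1 * (d ^ 2 * m ^ d) * (d ^ 2 * d ^ (2 * d.+1)))%N.
    have -> : (3 * d + 7 = d.+1 + 2 + (2 + 2 * d.+1))%N by lia.
    by rewrite !expnD; ring.
  apply: leq_mul; first by apply: leq_mul (e2 _) _; apply: leq_mul.
  by apply: leq_mul => //; apply: expl.
have ns : (nsample d m <= d ^ (3 * d + 18) * m ^ d)%N.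
  have -> : (d ^ (3 * d + 18) * m ^ d = d ^ 1 * d ^ (2 * 2) * (d ^ 1 * (d ^ (2 * 2) * d ^ 1 * (d ^ (3 * d + 7) * m ^ d))))%N.
    have -> : (3 * d + 18 = 1 + 2 * 2 + (1 + (2 * 2 + 1 + (3 * d + 7))))%N by lia.
    by rewrite !expnD; ring.
  have D22 : (d.+1 ^ 2 <= d ^ (2 * 2))%N by apply: expl.
  rewrite /nsample !expn1; apply: leq_mul; first exact: leq_mul.
  by apply: leq_mul => //; apply: leq_mul => //; apply: leq_mul.
have rs : (nsample d m + d.+1 <= d ^ (3 * d + 19) * m ^ d)%N.
  have -> : (3 * d + 19 = 1 + (3 * d + 18))%N by lia.
  rewrite expnD expn1 -mulnA; set P := (d ^ (3 * d + 18) * m ^ d)%N in ns *.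
  have : (d.+1 <= P)%N.
    apply: leq_trans D2 _; rewrite /P; apply: leq_trans (leq_pmulr _ _); last by rewrite expn_gt0 m0.
    by rewrite leq_pexp2l //; lia.
  by nia.
have nc : (ncodes d (nsample d m) <= d ^ (4 * d ^ 2 + 21 * d + 2) * m ^ (d ^ 2))%N.
  have -> : (d ^ (4 * d ^ 2 + 21 * d + 2) * m ^ (d ^ 2) =
             (d ^ (3 * d + 19) * m ^ d) ^ d * d ^ (d * d.+1) * d ^ d * d ^ 2)%N.
    have -> : (4 * d ^ 2 + 21 * d + 2 = (3 * d + 19) * d + d * d.+1 + d + 2)%N.
      by rewrite -mulnn; lia.
    rewrite expnMn -!expnM -mulnn (expnD d _ 2) (expnD d _ d) (expnD d _ (d * d.+1)).
    by rewrite mulnn; ring.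
  apply: leq_mul => //; apply: leq_mul (e2 _); apply: leq_mul; first by rewrite leq_exp2r.
  exact: expl.
have -> : (50 * d ^ 3 = (50 * d ^ 3 - (4 * d ^ 2 + 21 * d + 6)) + (1 + (4 * d ^ 2 + 21 * d + 2) + 3))%N.
  have : (4 * d ^ 2 + 21 * d + 6 <= 50 * d ^ 3)%N by rewrite !expnS expn0; nia.
  lia.
rewrite expnD -mulnA; apply: leq_trans (leq_pmull _ _); last by rewrite expn_gt0 d0.
have -> : (d ^ (1 + (4 * d ^ 2 + 21 * d + 2) + 3) * m ^ (d ^ 2) =
   d ^ 1 * (d ^ (4 * d ^ 2 + 21 * d + 2) * m ^ (d ^ 2)) * d ^ 3)%N by rewrite !expnD; ring.
by rewrite /loss !expn1; apply: leq_mul => //; apply: leq_mul.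
Qed.

Lemma extend_injective (G : finType) k n (f : 'I_k -> G) : injective f -> (k <= n.+1)%N -> (n < #|G|)%N ->
  exists2 f' : 'I_n.+1 -> G, injective f' & forall (i : 'I_k) (i' : 'I_n.+1), i' = i :> nat -> f' i' = f i.
Proof.
move=> fi kn nG; have [x0 _] : exists x0 : G, x0 \in predT by apply/card_gt0P/(leq_ltn_trans (leq0n n)).
pose s := codom f ++ [seq x <- enum G | x \notin codom f].
have us : uniq s.
  rewrite cat_uniq filter_uniq ?enum_uniq // andbT map_inj_uniq ?enum_uniq //=.
  by apply/hasPn => x; rewrite mem_filter => /andP[].
have sG : size s = #|G|.
  rewrite -(card_uniqP us); apply: eq_card => x.
  by rewrite mem_cat mem_filter mem_enum !inE andbT orbN.
exists (fun i => nth x0 s i) => [i j /eqP|i i' e].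
  rewrite nth_uniq ?sG //; first by move/eqP/val_inj.
    exact: leq_trans (ltn_ord i) nG.
  exact: leq_trans (ltn_ord j) nG.
by rewrite nth_cat size_codom card_ord e ltn_ord codomE (nth_map i) ?size_enum_ord // nth_ord_enum.
Qed.

(** Continuity of the power at [a] in explicit form: [(a + x)^d <= a^d + x M] on the unit
    interval. *)
Lemma limit_pow (R : realType) (c a : R) d : 0 <= a ->
  (forall N, (2 <= N)%N -> c <= (a + N%:R^-1) ^+ d) -> c <= a ^+ d.
Proof.
move=> a0 cN.
have [M M0 MP] : exists2 M, 0 <= M & forall x, 0 <= x <= 1 -> (a + x) ^+ d <= a ^+ d + x * M.
  elim: d {cN} => [|n [M M0 MP]].
    by exists 0 => // x _; rewrite !expr0 mulr0 addr0.
  exists (a ^+ n + (a + 1) * M); first by rewrite addr_ge0 ?exprn_ge0 // mulr_ge0 // addr_ge0.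
  move=> x /andP[x0 x1]; rewrite !exprS.
  have le := MP x; rewrite x0 x1 in le; have {}le := le isT.
  apply: le_trans (ler_wpM2l (addr_ge0 a0 x0) le) _.
  rewrite -subr_ge0; set an := a ^+ n.
  have -> : a * an + x * (an + (a + 1) * M) - (a + x) * (an + x * M) = x * ((1 - x) * M) by ring.
  by rewrite !mulr_ge0 // subr_ge0.
rewrite leNgt; apply/negP => lt.
pose N := (Num.truncn (M / (c - a ^+ d))).+2.
have c0 : 0 < c - a ^+ d by rewrite subr_gt0.
have N0 : 0 < N%:R :> R by rewrite ltr0n.
have MN : M < N%:R * (c - a ^+ d).
  rewrite -ltr_pdivrMr //; apply: lt_trans (truncnS_gt _) _.
  by rewrite /N ltr_nat.
have := cN N isT; rewrite leNgt => /negP; apply.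
apply: le_lt_trans (MP _ _) _.
  by rewrite invr_ge0 (ltW N0) /= invf_le1 // ler1n.
by rewrite -ltrBrDl mulrC ltr_pdivrMr // mulrC.
Qed.

(** * Perturbed grids and the upper bound *)

(** At most [d+1] points are extended to exactly [d+1], whose matrix [A] is invertible; its first
    [k] rows then have rank [k]. *)
Lemma gen_pos_image (R : realType) d (G : finType) (pnt : G -> pt R d) (S : {fset pt R d}) :
  (d < #|G|)%N -> (forall x, x \in S -> exists z, x = pnt z) ->
  (forall f : 'I_d.+1 -> G, injective f -> detrows (fun i => hom (pnt (f i))) != 0) -> gen_pos S.
Proof.
move=> dG Sp fP k p kd pi pS; have [f fE] := choice (fun i => Sp _ (pS i)).
have f_inj : injective f by move=> i j e; apply: pi; rewrite !fE e.
have [f' f'_inj f'E] := extend_injective f_inj kd dG.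
pose A : 'M[R]_(d.+1, 1 + d) := affmx (fun i => pnt (f' i)).
have Afree : row_free (A : 'M[R]_d.+1).
  by rewrite row_free_unit unitmxE unitfE; apply: fP.
have -> : affmx p = (pid_mx k : 'M[R]_(k, d.+1)) *m A.
  apply/row_matrixP => i; rewrite row_mul rowK -[row _ _ *m _]/(mulmx _ _).
  have -> : row i (pid_mx k : 'M[R]_(k, d.+1)) = delta_mx 0 (widen_ord kd i).
    apply/rowP => j; rewrite !mxE eqxx /= ltn_ord andbT eq_sym.
    by rewrite -(inj_eq val_inj).
  by rewrite -rowE rowK fE (f'E i).
by rewrite mxrankMfree // rank_pid_mx.
Qed.

Section Grid.
Variables (R : realType) (d m N : nat).
Hypotheses (d0 : (0 < d)%N) (m0 : (0 < m)%N) (dN : (d < m * N ^ d)%N).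

Let cell_ix := {ffun 'I_d -> 'I_N}.
Let G := ('I_m * cell_ix)%type.

Definition gpar (z : G) : R := (nat_of_ord (enum_rank z))%:R.
(** Enlarging the grid by [t] replaces shrinking the perturbation, which is a point of the moment
    curve. Once its coordinates are below [t], the layers stay apart. *)
Definition gpoint (t : R) (z : G) : pt R d := \row_j (t * (z.2 j)%:R + gpar z ^+ j.+1).

Lemma gpar_ge0 z : 0 <= gpar z.
Proof. by rewrite ler0n. Qed.

Lemma exists_grid_scale : exists t, [/\ 0 < t,
  forall z (j : 'I_d), gpar z ^+ j.+1 < t
  & forall f : 'I_d.+1 -> G, injective f -> detrows (fun i => hom (gpoint t (f i))) != 0].
Proof.
pose g (z : G) : 'rV[R]_d.+1 := \row_k (if unlift 0 k is Some j then (z.2 j)%:R else 0).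
pose t0 : R := \sum_z \sum_(j < d) gpar z ^+ j.+1.
have [|t tt0 tP] := exists_general_perturbation g (v := fun z => mcurve d (gpar z)) t0.
  move=> f fi; apply: (detrows_mcurve (s := fun i => gpar (f i))).
  by move=> i j /eqP; rewrite eqr_nat => /eqP/val_inj/enum_rank_inj/fi.
have pos z j : 0 <= gpar z ^+ j by rewrite exprn_ge0 ?gpar_ge0.
exists t; split.
- by apply: le_lt_trans tt0; apply: sumr_ge0 => z _; apply: sumr_ge0 => j _; apply: pos.
- move=> z j; apply: le_lt_trans tt0; rewrite /t0 (bigD1 z) //= (bigD1 j) //= -addrA lerDl addr_ge0 //.
    by apply: sumr_ge0 => k _; apply: pos.
  by apply: sumr_ge0 => y _; apply: sumr_ge0 => k _; apply: pos.
- move=> f /tP; congr (_ != 0); apply: eq_detrows => i; apply/rowP => k.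
  case: (unliftP 0 k) => [j ->|->]; rewrite ?hom_lift ?hom0 !mxE.
    by rewrite liftK.
  by rewrite unlift_none mulr0 add0r expr0.
Qed.

Variable t : R.
Hypotheses (t_gt0 : 0 < t) (t_par : forall z (j : 'I_d), gpar z ^+ j.+1 < t).
Hypothesis t_gp : forall f : 'I_d.+1 -> G, injective f -> detrows (fun i => hom (gpoint t (f i))) != 0.

Lemma gpoint_le (z : G) (j : 'I_d) k : (z.2 j <= k)%N -> gpoint t z 0 j < t * k.+1%:R.
Proof.
move=> le; rewrite mxE -natr1 mulrDr mulr1 ler_ltD //.
by rewrite ler_pM2l // ler_nat.
Qed.

Lemma gpoint_gt (z : G) (j : 'I_d) k : (k < z.2 j)%N -> t * k.+1%:R <= gpoint t z 0 j.
Proof.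
move=> lt; rewrite mxE; apply: (@le_trans _ _ (t * (z.2 j)%:R)).
  by rewrite ler_pM2l // ler_nat.
by rewrite lerDl exprn_ge0 ?gpar_ge0.
Qed.

Lemma gpoint_inj : injective (gpoint t).
Proof.
move=> z y e; have c_eq : z.2 = y.2.
  apply/ffunP => j; apply/val_inj; case: (ltngtP (z.2 j) (y.2 j)) => // lt.
    by have := lt_le_trans (gpoint_le (leqnn (z.2 j))) (gpoint_gt lt); rewrite e ltxx.
  by have := lt_le_trans (gpoint_le (leqnn (y.2 j))) (gpoint_gt lt); rewrite e ltxx.
move/rowP/(_ (Ordinal d0)): e; rewrite !mxE c_eq => /addrI/eqP.
by rewrite !expr1 eqr_nat => /eqP/val_inj/enum_rank_inj.
Qed.

Definition gridX (i : 'I_m) : {fset pt R d} := [fset gpoint t (i, c) | c : cell_ix]%fset.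

Lemma gridXP i x : reflect (exists c, x = gpoint t (i, c)) (x \in gridX i).
Proof.
apply: (iffP idP) => [/imfsetP[c _ ->]|[c ->]]; first by exists c.
by apply/imfsetP; exists c.
Qed.

Lemma card_gridX i : #|` gridX i| = (N ^ d)%N.
Proof.
rewrite card_imfset /=; last by move=> c c' /gpoint_inj[].
by rewrite -cardE card_ffun !card_ord.
Qed.

Lemma gridX_neq0 i : gridX i != fset0.
Proof.
rewrite -cardfs_gt0 card_gridX; case: (posnP (N ^ d)%N) dN => // ->.
by rewrite muln0.
Qed.

Lemma gridX_gen_pos : family_gen_pos gridX.
Proof.
split=> [i j ij|].
  apply/fdisjointP => x /gridXP[c ->]; apply/negP => /gridXP[c' /gpoint_inj[e]].
  by rewrite e eqxx in ij.
apply: (gen_pos_image (pnt := gpoint t)) => //.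
  by rewrite card_prod card_ffun !card_ord.
by move=> x /bigfcupP[i _ /gridXP[c ->]]; exists (i, c).
Qed.

Variable Y : 'I_m -> {fset pt R d}.
Hypotheses (YX : forall i, (Y i `<=` gridX i)%fset) (Yst : same_type Y).

Definition gixs i := [set c : cell_ix | gpoint t (i, c) \in Y i].

Lemma card_gixs i : #|` Y i| = #|gixs i|.
Proof.
have -> : Y i = [fset gpoint t (i, c) | c in gixs i]%fset.
  apply/fsetP => x; apply/idP/imfsetP => [xY|[c /=]]; last by rewrite inE => ? ->.
  have /gridXP[c xE] := fsubsetP (YX i) x xY.
  by exists c; rewrite //= inE -xE.
rewrite card_imfset /=; last by move=> c c' /gpoint_inj[].
by rewrite -cardE.
Qed.

(** The hyperplane [x_j = t (k+1)], between the layers [k] and [k+1], separates points of [Y i]. *)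
Definition gcross i (j : 'I_d) (k : 'I_N) :=
  [exists c in gixs i, (c j <= k)%N] && [exists c in gixs i, (k < c j)%N].

(* Points of [d+1] of the convex hulls on one hyperplane would make a determinant vanish that is a positive
   combination of determinants of one and the same sign. *)
Lemma card_gcross j k : (#|[set i | gcross i j k]| <= d)%N.
Proof.
rewrite leqNgt; apply/negP => lt.
pose f (l : 'I_d.+1) := enum_val (widen_ord lt l).
have fi : injective f by move=> l l' /enum_val_inj/(congr1 val)/= e; apply: val_inj.
have fc l : gcross (f l) j k by have := enum_valP (widen_ord lt l); rewrite inE.
pose h : 'rV[R]_d.+1 := delta_mx 0 (lift 0 j) - (t * k.+1%:R) *: delta_mx 0 0.
have hE p : dot h (hom p) = p 0 j - t * k.+1%:R.
  by rewrite dotBl dotZl !dot_delta hom_lift hom0 mulr1.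
have exl l : exists c : cell_ix, c \in gixs (f l) /\ (c j <= k)%N.
  by have /andP[/exists_inP[c cY lec] _] := fc l; exists c.
have exh l : exists c : cell_ix, c \in gixs (f l) /\ (k < c j)%N.
  by have /andP[_ /exists_inP[c cY lec]] := fc l; exists c.
have [lo loP] := choice exl; have [hi hiP] := choice exh.
pose ylo l := gpoint t (f l, lo l); pose yhi l := gpoint t (f l, hi l).
have ylo_in l : ylo l \in Y (f l) by have [] := loP l; rewrite inE.
have yhi_in l : yhi l \in Y (f l) by have [] := hiP l; rewrite inE.
have hlo l : dot h (hom (ylo l)) < 0 by rewrite hE subr_lt0; apply: gpoint_le; have [] := loP l.
have hhi l : 0 <= dot h (hom (yhi l)) by rewrite hE subr_ge0; apply: gpoint_gt; have [] := hiP l.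
pose s := orientation ylo.
have detn0 y : (forall l, y l \in Y (f l)) -> detrows (fun l => hom (y l)) != 0.
  move=> yY; apply: (family_detrows gridX_gen_pos fi) => l.
  exact: (fsubsetP (YX _)) (yY l).
(* Up to scale, the point where the segment from [ylo l] to [yhi l] meets the hyperplane [h]. *)
pose p l := dot h (hom (yhi l)) *: hom (ylo l) + (- dot h (hom (ylo l))) *: hom (yhi l).
have : 0 < s * detrows p.
  apply: (detrows_propagate (P := fun r => 0 < s * r) (A := fun l x => exists2 y, y \in Y (f l) & x = hom y)
    (A' := fun l x => x = p l)) => // [l w Aw x ->|y yY].
    have lo0 : 0 < s * dot (hom (ylo l)) w by apply: Aw; exists (ylo l).
    have hi0 : 0 < s * dot (hom (yhi l)) w by apply: Aw; exists (yhi l).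
    rewrite /p dotDl !dotZl mulrDr mulrCA [X in _ + X]mulrCA; apply: ltr_wpDl.
      by rewrite mulr_ge0 // ltW.
    by rewrite mulr_gt0 // oppr_gt0.
  have exz l : exists z, z \in Y (f l) /\ y l = hom z by have [z] := yY l; exists z.
  have [z zP] := choice exz.
  have zY l : z l \in Y (f l) by have [] := zP l.
  have -> : detrows y = detrows (fun l => hom (z l)) by apply: eq_detrows => l; have [] := zP l.
  have -> : s = Num.sg (detrows (fun l => hom (z l))) by rewrite -orientationE; apply: Yst fi _ _ ylo_in zY.
  by rewrite -normrEsg normr_gt0 detn0.
suff /eqP -> : detrows p == 0 by rewrite mulr0 ltxx.
apply/detrows_eq0P; exists h => [|l].
  by apply: contraTneq (hlo ord0) => ->; rewrite dot0l ltxx.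
by rewrite /p dotDl !dotZl !(dotC _ h); ring.
Qed.

Definition gwidth i j := #|[set k | gcross i j k]|.

(** In each direction a cell is located by the number of separating hyperplanes below it: every
    hyperplane between two cells of [Y i] is separating, so these counts distinguish them. *)
Lemma card_gixs_leq i : (#|gixs i| <= \prod_j (gwidth i j).+1)%N.
Proof.
have lt (c : cell_ix) j : (#|[set k | gcross i j k & (k < c j)%N]| < N.+1)%N.
  by rewrite ltnS -[X in (_ <= X)%N](card_ord N) max_card.
pose F j := [pred n : 'I_N.+1 | (n < (gwidth i j).+1)%N].
pose phi (c : cell_ix) : {ffun 'I_d -> 'I_N.+1} := [ffun j => Ordinal (lt c j)].
have phi_inj : {in gixs i &, injective phi}.
  have mono (c c' : cell_ix) j : c \in gixs i -> c' \in gixs i -> phi c = phi c' -> (c j < c' j)%N -> False.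
    move=> cY cY' /ffunP/(_ j); rewrite !ffunE => /(congr1 val)/= e ltc; move/eqP: e; apply/negP.
    rewrite neq_ltn; apply/orP; left; apply: proper_card; apply/properP; split.
      by apply/subsetP => k; rewrite !inE => /andP[-> /ltn_trans]; apply.
    exists (c j); last by rewrite inE ltnn andbF.
    rewrite inE ltc andbT.
    by apply/andP; split; apply/exists_inP; [exists c | exists c'].
  move=> c c' cY cY' e; apply/ffunP => j; apply/val_inj; case: (ltngtP (c j) (c' j)) => // ltc.
    by case: (mono c c' j cY cY' e ltc).
  by case: (mono c' c j cY' cY (esym e) ltc).
rewrite -(card_in_imset phi_inj).
have -> : (\prod_j (gwidth i j).+1 = #|family F|)%N.
  rewrite card_family foldrE big_map big_enum /=; apply: eq_bigr => j _.
  have wN : ((gwidth i j).+1 <= N.+1)%N by rewrite ltnS -[X in (_ <= X)%N](card_ord N) max_card.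
  rewrite -[LHS]card_ord -(card_codom (f := widen_ord wN)) //; last first.
    by move=> a b /(congr1 val)/= e; apply: val_inj.
  apply: eq_card => n; rewrite [RHS]unfold_in; apply/codomP/idP => [[a ->]|ltn]; first exact: ltn_ord a.
  by exists (Ordinal ltn); apply: val_inj.
apply: subset_leq_card; apply/subsetP => g /imsetP[c _ ->]; apply/familyP => j.
rewrite inE ffunE /= ltnS; apply: subset_leq_card.
by apply/subsetP => k; rewrite !inE => /andP[].
Qed.

Lemma exists_small_width : exists i, (m * \sum_j gwidth i j <= d ^ 2 * N)%N.
Proof.
apply: contrapT => no.
have lo : (\sum_(i < m) (d ^ 2 * N) < \sum_(i < m) m * \sum_j gwidth i j)%N.
  have all_lt i : (d ^ 2 * N < m * \sum_j gwidth i j)%N.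
    by rewrite ltnNge; apply/negP => le; apply: no; exists i.
  rewrite (bigD1 (Ordinal m0)) //= [X in (_ < X)%N](bigD1 (Ordinal m0)) //=.
  by rewrite -addSn leq_add //; apply: leq_sum => i _; apply: ltnW.
move: lo; rewrite ltnNge => /negP; apply.
rewrite sum_nat_const card_ord -big_distrr leq_mul2l; apply/orP; right.
rewrite exchange_big /=; apply: (@leq_trans (\sum_(j < d) \sum_(k < N) d)); last first.
  by rewrite !sum_nat_const !card_ord -mulnn; apply: eq_leq; ring.
apply: leq_sum => j _; under eq_bigr => i _ do rewrite /gwidth (cards_sum (gcross i j)).
rewrite exchange_big; apply: leq_sum => k _.
by rewrite -(cards_sum (fun i => gcross i j k)) card_gcross.
Qed.

Lemma same_type_grid_bound (c : R) : (forall i, c * (#|` gridX i|)%:R <= (#|` Y i|)%:R) ->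
  c <= (d%:R / m%:R + N%:R^-1) ^+ d.
Proof.
have N0 : (0 < N)%N by case: (N) dN d0 => [|//]; case: (d) => // n; rewrite exp0n // muln0.
have [i iw] := exists_small_width => /(_ i); rewrite card_gridX card_gixs.
have dR : 0 < d%:R :> R by rewrite ltr0n.
have mR : 0 < m%:R :> R by rewrite ltr0n.
have NR : 0 < N%:R :> R by rewrite ltr0n.
have up : (#|gixs i|)%:R <= ((\sum_j (gwidth i j).+1%:R) / d%:R : R) ^+ d.
  have := @leif_AGM R 'I_d predT (fun j => (gwidth i j).+1%:R) (fun j _ => ler0n _ _).
  rewrite (eq_card (B := 'I_d)) // card_ord => -[le _]; apply: le_trans le.
  by rewrite -natr_prod ler_nat card_gixs_leq.
move=> /le_trans/(_ up); rewrite natrX -ler_pdivlMr ?exprn_gt0 // -expr_div_n => /le_trans; apply.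
apply: lerXn2r; rewrite ?nnegrE ?divr_ge0 ?sumr_ge0 ?addr_ge0 ?invr_ge0 ?ler0n // ?divr_ge0 ?ler0n //.
rewrite ler_pdivrMr // ler_pdivrMr //.
have -> : (d%:R / m%:R + N%:R^-1) * N%:R * d%:R = (d ^ 2 * N)%:R / m%:R + d%:R :> R.
  by rewrite natrM natrX; field; rewrite !gt_eqF.
under eq_bigr => j _ do rewrite -natr1.
rewrite big_split /= sumr_const card_ord lerD2r ler_pdivlMr // -natr_sum -natrM ler_nat mulnC.
exact: iw.
Qed.

End Grid.

(* From finite families to the supremum and infimum *)
From mathcomp Require Import classical_sets.
Local Open Scope ring_scope.

Lemma cX_bounded (R : realType) d m (X : 'I_m -> {fset pt R d}) (c : R) : (0 < m)%N ->
  (forall i, X i != fset0) ->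
  (exists Y : 'I_m -> {fset pt R d}, (forall i, (Y i `<=` X i)%fset) /\ same_type Y /\
    (forall i, c * (#|` X i|)%:R <= (#|` Y i|)%:R)) -> c <= 1.
Proof.
move=> m0 X0 [Y [YX [_ cY]]]; pose i := Ordinal m0.
have Xi : 0 < (#|` X i|)%:R :> R by rewrite ltr0n cardfs_gt0.
by rewrite -(ler_pM2r Xi) mul1r (le_trans (cY i)) // ler_nat fsubset_leq_card.
Qed.

Lemma loss_leq_cX (R : realType) d m (X : 'I_m -> {fset pt R d}) : (0 < m)%N ->
  (forall i, X i != fset0) -> family_gen_pos X -> (loss d m)%:R^-1 <= cX X.
Proof.
move=> m0 X0 gX; have [Y [YX Yst nY]] := exists_same_type m0 X0 gX.
apply: ub_le_sup; first by exists 1 => c; apply: cX_bounded.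
exists Y; split=> //; split=> // i.
have [l0|l0] := posnP (loss d m); first by rewrite l0 invr0 mul0r ler0n.
by rewrite mulrC ler_pdivrMr ?ltr0n // -natrM ler_nat mulnC.
Qed.

Lemma exists_grid_family (R : realType) d m N : (0 < d)%N -> (0 < m)%N -> (d < m * N ^ d)%N ->
  exists X : 'I_m -> {fset pt R d}, [/\ forall i, X i != fset0, family_gen_pos X
    & cX X <= (d%:R / m%:R + N%:R^-1) ^+ d].
Proof.
move=> d0 m0 dN; have [t [t_gt0 t_par t_gp]] := exists_grid_scale R d m N.
exists (@gridX R d m N t); split; [exact: gridX_neq0 | exact: gridX_gen_pos |].
apply: ge_sup => [|c [Y [YX [Yst cY]]]].
  exists 0, (fun=> fset0); split=> [i|]; first exact: fsub0set.
  by split=> [f _ y y' /(_ ord0)|i]; rewrite ?inE // mul0r.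
exact: (same_type_grid_bound d0 m0 dN t_gt0 t_par t_gp YX Yst cY).
Qed.

Theorem theorem1 (R : realType) (d m : nat) (hd : (2 <= d)%N) (hm : (d <= m)%N) :
  (d%:R ^- (50 * d ^ 3)%N) * (m%:R ^- (d ^ 2)%N) <= c_md R d m /\
  c_md R d m <= (d%:R ^+ d) * (m%:R ^- d) :> R.
Proof.
have d0 : (0 < d)%N by apply: leq_trans hd.
have m0 : (0 < m)%N by apply: leq_trans hm.
have fam N (hN : (2 <= N)%N) : exists X : 'I_m -> {fset pt R d}, [/\ forall i, X i != fset0, family_gen_pos X
    & cX X <= (d%:R / m%:R + N%:R^-1) ^+ d].
  (* The grids have more than [d] points in total: [d < 2^d <= N^d <= m N^d]. *)
  apply: exists_grid_family => //; apply: leq_trans (leq_pmull _ m0).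
  by apply: leq_trans (ltn_expl d (isT : 1 < 2)%N) _; rewrite leq_exp2r.
have lb : lbound [set c : R | exists X : 'I_m -> {fset pt R d},
    (forall i, X i != fset0) /\ family_gen_pos X /\ c = cX X]%classic (loss d m)%:R^-1.
  by move=> _ [X [X0 [gX ->]]]; apply: loss_leq_cX.
split.
  apply: (@le_trans _ _ (loss d m)%:R^-1).
    have l0 : (0 < loss d m)%N by rewrite /loss /ncodes !muln_gt0 !expn_gt0 addn_gt0 !orbT.
    rewrite -invfM -!natrX -natrM lef_pV2 ?posrE ?ltr0n //; last by rewrite muln_gt0 !expn_gt0 d0 m0.
    by rewrite ler_nat loss_leq.
  rewrite /c_md; apply: lb_le_inf => //; have [X [X0 gX _]] := fam 2%N isT.
  by exists (cX X), X.
(* The infimum is at most the value of every grid family; then [N] tends to infinity. *)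
rewrite -expr_div_n; apply: limit_pow => [|N hN]; first by rewrite divr_ge0.
have [X [X0 gX le]] := fam N hN; apply: le_trans le.
by rewrite /c_md; apply: ge_inf; [exists (loss d m)%:R^-1 | exists X].
Qed.
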